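(* Let $1\le k\le n-1$. Then there exists a set $\Omega_k\subset B$, where $B$ is a fixed ball of $\mathbb{R}^n$, such that $C_T(\Omega_k,k)$ and $C_N(\Omega_k,n-k)$ are arbitrarily large; that is, for every $M>0$ there is a set $\Omega_k\subset B$ (with $B$ independent of $M$) such that $C_T(\Omega_k,k)>M$ and $C_N(\Omega_k,n-k)>M$.
   Context: For a bounded open set $\Omega\subset\mathbb{R}^n$ with outward unit normal $\nu$ to $\partial\Omega$, let $W_T^{1,2}(\Omega;\Lambda^k)$ (resp. $W_N^{1,2}(\Omega;\Lambda^k)$) be the space of $k$-forms $\omega\in W^{1,2}(\Omega;\Lambda^k)$ with $\nu\wedge\omega=0$ (resp. $\nu\lrcorner\omega=0$) on $\partial\Omega$. With $L^2(\Omega)$-norms $\|\cdot\|$, $$C_T(\Omega,k)=\sup_{\omega\in W_T^{1,2}\setminus\{0\}}\frac{\|\nabla\omega\|^2}{\|d\omega\|^2+\|\delta\omega\|^2+\|\omega\|^2},\qquad C_N(\Omega,k)=\sup_{\omega\in W_N^{1,2}\setminus\{0\}}\frac{\|\nabla\omega\|^2}{\|d\omega\|^2+\|\delta\omega\|^2+\|\omega\|^2},$$ where the suprema are over $k$-forms. Here components $\omega^{i_1\cdots i_k}$ are antisymmetric in the indices, $|\omega|^2=\sum_{i_1<\cdots<i_k}(\omega^{i_1\cdots i_k})^2$ (and similarly $|\nabla\omega|^2$ sums the squares of all first partial derivatives of these components), $(\nu\lrcorner\omega)^{i_1\cdots i_{k-1}}=\sum_j\nu^j\omega^{ji_1\cdots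 i_{k-1}}$, $d$ is the exterior derivative and $(\delta\omega)^{i_1\cdots i_{k-1}}=\sum_j\partial_{x_j}\omega^{ji_1\cdots i_{k-1}}$. *)

(* Defs.v *)
From HB Require Import structures.
From mathcomp Require Import all_boot all_order all_algebra all_fingroup.
From mathcomp Require Import all_classical all_reals all_analysis.
Set Implicit Arguments.
Unset Strict Implicit.
Unset Printing Implicit Defensive.
Import Order.TTheory GRing.Theory Num.Theory.
Import numFieldTopology.Exports numFieldNormedType.Exports.
Local Open Scope classical_set_scope.
Local Open Scope ring_scope.

(** The sigma-algebra generated by the coordinates, that is, the Borel
    sigma-algebra of [R^n]. *)
Section measurable_rV.
Context (R : realType) (n : nat).

Let coord : 'I_n -> 'rV[R]_n -> measurableTypeR R := fun i v => v ord0 i.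

Let rV_set0 : g_sigma_preimage coord set0.
Proof. exact: sigma_algebra0. Qed.

Let rV_setC A : g_sigma_preimage coord A -> g_sigma_preimage coord (~` A).
Proof. exact: sigma_algebraC. Qed.

Let rV_bigcup (F : _^nat) : (forall i, g_sigma_preimage coord (F i)) ->
  g_sigma_preimage coord (\bigcup_i (F i)).
Proof. exact: sigma_algebra_bigcup. Qed.

HB.instance Definition _ := @isMeasurable.Build default_measure_display
  'rV[R]_n (g_sigma_preimage coord) rV_set0 rV_setC rV_bigcup.

Lemma measurable_coord (i : 'I_n) :
  measurable_fun [set: 'rV[R]_n] (fun v => v ord0 i : measurableTypeR R).
Proof.
move=> _ Y mY; rewrite setTI; apply: sub_sigma_algebra => /=.
rewrite -bigcup_seq/=; exists i => /=; first by rewrite mem_index_enum.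
by exists Y => //; rewrite setTI.
Qed.

Lemma measurable_fun_rV d (T : measurableType d) (f : T -> 'rV[R]_n) :
  (forall i, measurable_fun [set: T] (fun x => f x ord0 i : measurableTypeR R)) ->
  measurable_fun [set: T] f.
Proof.
move=> mf _ Y; rewrite /measurable/= => mY; rewrite setTI.
have smem : sigma_algebra [set: 'rV[R]_n] [set A | measurable (f @^-1` A)].
  split => /=.
  - by rewrite preimage_set0; exact: measurable0.
  - by move=> A mA; rewrite setTD preimage_setC; exact: measurableC.
  - by move=> F mF; rewrite preimage_bigcup; exact: bigcup_measurable.
apply: (mY [set A | measurable (f @^-1` A)]); split=> //.
move=> A; rewrite -bigcup_seq/= => -[i _ [B mB <-]].
by rewrite setTI/=; have := mf i measurableT B mB; rewrite setTI.
Qed.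

End measurable_rV.

(** [R * R^n] is identified with [R^(n+1)], the new coordinate being the first. *)
Definition rV_cons (R : realType) (n : nat)
    (p : measurableTypeR R * 'rV[R]_n) : 'rV[R]_n.+1 :=
  \row_i if unlift ord0 i is Some j then p.2 ord0 j else p.1.

Definition rV_uncons (R : realType) (n : nat) (v : 'rV[R]_n.+1) :
    measurableTypeR R * 'rV[R]_n :=
  (v ord0 ord0, \row_j v ord0 (lift ord0 j)).

Lemma rV_consK (R : realType) n : cancel (@rV_cons R n) (@rV_uncons R n).
Proof.
move=> [x y]; rewrite /rV_uncons mxE unlift_none; congr pair.
by apply/rowP => j; rewrite !mxE liftK.
Qed.

Lemma rV_unconsK (R : realType) n : cancel (@rV_uncons R n) (@rV_cons R n).
Proof.
move=> v; apply/rowP => i; rewrite mxE.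
by case: unliftP => [j ->|->] //=; rewrite mxE.
Qed.

Lemma measurable_rV_cons (R : realType) n :
  measurable_fun [set: measurableTypeR R * 'rV[R]_n] (@rV_cons R n).
Proof.
apply: measurable_fun_rV => i; case: (unliftP ord0 i) => [j|] ->.
  under eq_fun do rewrite mxE liftK.
  exact: (measurableT_comp (measurable_coord j) measurable_snd).
by under eq_fun do rewrite mxE unlift_none; exact: measurable_fst.
Qed.

Lemma measurable_rV_uncons (R : realType) n :
  measurable_fun [set: 'rV[R]_n.+1] (@rV_uncons R n).
Proof.
apply: measurable_fun_pair; first exact: measurable_coord.
apply: measurable_fun_rV => i; under eq_fun do rewrite mxE.
exact: measurable_coord.
Qed.

Section rV_measure.
Context (R : realType) (n : nat).
Variable m : {sigma_finite_measure set 'rV[R]_n -> \bar R}.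

Definition rV_product : set 'rV[R]_n.+1 -> \bar R :=
  pushforward (@lebesgue_measure R \x m)%E (@rV_cons R n).

Let prod_meas : {measure set (measurableTypeR R * 'rV[R]_n)%type -> \bar R} :=
  (@lebesgue_measure R \x m)%E.

Let rV_product0 : rV_product set0 = 0.
Proof. by rewrite /rV_product /pushforward preimage_set0 measure0. Qed.

Let rV_product_ge0 A : (0 <= rV_product A)%E.
Proof. exact: (measure_ge0 prod_meas). Qed.

Let rV_product_sigma_additive : semi_sigma_additive rV_product.
Proof.
move=> F mF tF mUF; rewrite /rV_product /pushforward preimage_bigcup.
have mcons A : measurable A -> measurable (@rV_cons R n @^-1` A).
  by move=> mA; rewrite -[X in measurable X]setTI; exact: measurable_rV_cons.
apply: (@measure_semi_sigma_additive _ _ _ prod_meas).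
- by move=> i; exact: mcons.
- apply/trivIsetP => /= i j _ _ ij; rewrite -preimage_setI.
  by move/trivIsetP : tF => /(_ _ _ _ _ ij) ->//; rewrite preimage_set0.
- by rewrite -preimage_bigcup; exact: mcons.
Qed.

HB.instance Definition _ := isMeasure.Build _ _ _ rV_product
  rV_product0 rV_product_ge0 rV_product_sigma_additive.

Let rV_product_sigma_finite : sigma_finite setT rV_product.
Proof.
have /sigma_finiteP[F [TF ndF Foo]] := sigma_finiteT (@lebesgue_measure R).
have /sigma_finiteP[G [TG ndG Goo]] := sigma_finiteT m.
exists (fun i => @rV_uncons R n @^-1` (F i `*` G i)) => [|i].
  rewrite -preimage_bigcup (_ : \bigcup_i _ = setT) ?preimage_setT//.
  apply/seteqP; split => // -[x y] _.
  have [i _ Fx] : (\bigcup_i F i) x by rewrite -TF.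
  have [j _ Gy] : (\bigcup_i G i) y by rewrite -TG.
  exists (maxn i j) => //; split.
    by move: x Fx; exact/subsetPset/ndF/leq_maxl.
  by move: y Gy; exact/subsetPset/ndG/leq_maxr.
have [mFi Fi] := Foo i; have [mGi Gi] := Goo i; split.
  rewrite -[X in measurable X]setTI; apply: measurable_rV_uncons => //.
  exact: measurableX.
rewrite /rV_product /pushforward -comp_preimage (_ : _ \o _ = id).
  rewrite preimage_id product_measure1E//.
  by rewrite lte_mul_pinfty// ge0_fin_numE.
by apply/funext => x /=; rewrite rV_consK.
Qed.

HB.instance Definition _ := Measure_isSigmaFinite.Build _ _ _ rV_product
  rV_product_sigma_finite.

End rV_measure.

(** The [n]-fold product of the Lebesgue measure of [R]. *)
Fixpoint lebesgue_rV (R : realType) (n : nat) :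
    {sigma_finite_measure set 'rV[R]_n -> \bar R} :=
  if n is n'.+1 then rV_product (lebesgue_rV R n') else \d_(0 : 'rV[R]_0).

Definition enorm (R : realType) n (v : 'rV[R]_n) : R :=
  Num.sqrt (\sum_(i < n) v ord0 i ^+ 2).

Definition eball (R : realType) n (c : 'rV[R]_n) (r : R) : set 'rV[R]_n :=
  [set x | enorm (x - c) < r].

Definition boundary (T : topologicalType) (A : set T) : set T :=
  closure A `\` interior A.

(** Adjoining [0] to the distances makes the diameter of the empty set [0]. *)
Definition ediam (R : realType) n (A : set 'rV[R]_n) : \bar R :=
  ereal_sup [set d | d = 0%E \/
    exists x y, [/\ A x, A y & d = (enorm (x - y))%:E]].

Definition hausdorff_content (R : realType) n (s : nat) (e : R)
    (A : set 'rV[R]_n) : \bar R :=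
  ereal_inf [set (\sum_(i <oo) ediam (C i) ^+ s)%E | C in
    [set C : (set 'rV[R]_n)^nat | A `<=` \bigcup_i C i /\
                                  forall i, (ediam (C i) <= e%:E)%E]].

(** Without the constant normalising it to surface area: it is only used for
    null sets and for convergence to [0].  It is an outer measure, and a measure
    on Borel sets; the integrals below are those of Borel functions.  It is
    meant for [s >= 1] (for [s = 0] empty pieces would be counted). *)
Definition hausdorff_measure (R : realType) n (s : nat)
    (A : set 'rV[R]_n) : \bar R :=
  ereal_sup [set hausdorff_content s e A | e in [set e : R | 0 < e]].

Definition partial (R : realType) n (i : 'I_n) (f : 'rV[R]_n -> R) :
    'rV[R]_n -> R :=
  fun x => 'D_(delta_mx ord0 i) f x.

Fixpoint Cr (R : realType) n (r : nat) (U : set 'rV[R]_n)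
    (f : 'rV[R]_n -> R) : Prop :=
  (forall x, U x -> {for x, continuous f}) /\
  if r is r'.+1 then
    forall i : 'I_n, (forall x, U x -> derivable f x (delta_mx ord0 i)) /\
                     Cr r' U (partial i f)
  else True.

Definition smooth (R : realType) n (U : set 'rV[R]_n) (f : 'rV[R]_n -> R) :=
  forall r, Cr r U f.

Definition grad (R : realType) n (f : 'rV[R]_n -> R) (x : 'rV[R]_n) :
    'rV[R]_n :=
  \row_i partial i f x.

(** The domain lies locally on one side of the hypersurface [f = 0]; at a boundary
    point [f] vanishes and its gradient points outwards. *)
Definition local_defining_function (R : realType) n (W : set 'rV[R]_n)
    (x : 'rV[R]_n) (U : set 'rV[R]_n) (f : 'rV[R]_n -> R) : Prop :=
  [/\ open U, U x, smooth U f, grad f x != 0 &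
      forall y, U y -> (W y <-> f y < 0)].

Definition smooth_domain (R : realType) n (W : set 'rV[R]_n) : Prop :=
  [/\ open W, bounded_set W &
      forall x, boundary W x -> exists U f, local_defining_function W x U f].

Definition outward_unit_normal (R : realType) n (W : set 'rV[R]_n)
    (x v : 'rV[R]_n) : Prop :=
  exists U f, local_defining_function W x U f /\
              v = (enorm (grad f x))^-1 *: grad f x.

(** A [k]-covector is given by all its components, indexed by [k]-tuples of
    indices. *)
Definition alternating_covector (R : realType) n k (a : k.-tuple 'I_n -> R) : Prop :=
  forall (s : 'S_k) (J : k.-tuple 'I_n),
    a [tuple tnth J (s l) | l < k] = (-1) ^+ s * a J.

Definition increasing n k (J : k.-tuple 'I_n) : bool :=
  sorted ltn [seq val j | j <- J].

Definition sqnorm (R : realType) n k (a : k.-tuple 'I_n -> R) : R :=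
  \sum_(J : k.-tuple 'I_n | increasing J) a J ^+ 2.

Definition skew (R : realType) n k (G : 'I_n -> k.-tuple 'I_n -> R) :
    k.+1.-tuple 'I_n -> R :=
  fun J => \sum_(l < k.+1)
    (-1) ^+ l * G (tnth J l) [tuple tnth J (lift l p) | p < k].

(** On [0]-covectors the contraction is [0]. *)
Definition contract (R : realType) n k :
    ('I_n -> k.-tuple 'I_n -> R) -> k.-1.-tuple 'I_n -> R :=
  match k with
  | 0 => fun _ _ => 0
  | k'.+1 => fun G J => \sum_(j < n) G j [tuple of j :: J]
  end.

Definition wedge (R : realType) n k (v : 'rV[R]_n) (a : k.-tuple 'I_n -> R) :=
  skew (fun j J => v ord0 j * a J).

Definition interior_product (R : realType) n k (v : 'rV[R]_n)
    (a : k.-tuple 'I_n -> R) :=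
  contract (fun j J => v ord0 j * a J).

Definition sqnorm_int (R : realType) n (mu : set 'rV[R]_n -> \bar R)
    (D : set 'rV[R]_n) (u : 'rV[R]_n -> R) : \bar R :=
  (\int[mu]_(x in D) (u x ^+ 2)%R%:E)%E.

Definition L2 (R : realType) n (W : set 'rV[R]_n) (u : 'rV[R]_n -> R) : Prop :=
  measurable_fun W (u : _ -> measurableTypeR R) /\
  (sqnorm_int (lebesgue_rV R n) W u < +oo)%E.

Definition test_function (R : realType) n (W : set 'rV[R]_n)
    (phi : 'rV[R]_n -> R) : Prop :=
  smooth setT phi /\
  exists K, [/\ compact K, K `<=` W & forall x, ~ K x -> phi x = 0].

Definition weak_partial (R : realType) n (W : set 'rV[R]_n) (i : 'I_n)
    (u v : 'rV[R]_n -> R) : Prop :=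
  forall phi, test_function W phi ->
    \int[lebesgue_rV R n]_(x in W) (u x * partial i phi x) =
    - \int[lebesgue_rV R n]_(x in W) (v x * phi x).

(** A form is a field [w] of covectors; an element of [W^{1,2}] comes with its
    weak gradient [Dw], where [Dw x j J] is the weak derivative in the direction
    [j] of the component [J] at [x].  As [Dw] is determined by [w] almost
    everywhere, [d], [delta] and their norms are those of [w]. *)
Section forms.
Context (R : realType) (n : nat).
Local Notation form k := ('rV[R]_n -> k.-tuple 'I_n -> R).
Local Notation gradient k := ('rV[R]_n -> 'I_n -> k.-tuple 'I_n -> R).

Definition W12 (W : set 'rV[R]_n) k (w : form k) (Dw : gradient k) : Prop :=
  (forall x, W x -> alternating_covector (w x)) /\
  forall J, L2 W (fun x => w x J) /\
    forall j, L2 W (fun x => Dw x j J) /\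
              weak_partial W j (fun x => w x J) (fun x => Dw x j J).

Definition ext_d k (Dw : gradient k) : form k.+1 := fun x => skew (Dw x).

Definition codiff k (Dw : gradient k) : form k.-1 := fun x => contract (Dw x).

Definition sqnorm_L2 (W : set 'rV[R]_n) k (w : form k) : \bar R :=
  (\int[lebesgue_rV R n]_(x in W) (sqnorm (w x))%:E)%E.

Definition sqnorm_grad (W : set 'rV[R]_n) k (Dw : gradient k) : \bar R :=
  (\int[lebesgue_rV R n]_(x in W) (\sum_(j < n) sqnorm (Dw x j))%R%:E)%E.

(** [g] is the trace on the boundary of [u] in [W^{1,2}] (with weak gradient
    [Du]): the limit in [L^2] of the boundary for the surface measure of the
    restrictions of functions, [C^1] up to the boundary, tending to [u] in
    [W^{1,2}]. *)
Definition is_trace (W : set 'rV[R]_n) (u : 'rV[R]_n -> R)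
    (Du : 'rV[R]_n -> 'I_n -> R) (g : 'rV[R]_n -> R) : Prop :=
  measurable_fun (boundary W) (g : _ -> measurableTypeR R) /\
  exists v : nat -> 'rV[R]_n -> R,
    [/\ forall m, exists U, [/\ open U, closure W `<=` U & Cr 1 U (v m)],
        sqnorm_int (lebesgue_rV R n) W (fun x => v m x - u x)
          @[m --> \oo] --> 0%E,
        forall j,
          sqnorm_int (lebesgue_rV R n) W (fun x => partial j (v m) x - Du x j)
            @[m --> \oo] --> 0%E &
        sqnorm_int (hausdorff_measure n.-1) (boundary W)
          (fun x => v m x - g x) @[m --> \oo] --> 0%E].

(** The trace of [w] satisfies [P nu], with [nu] the outward unit normal, almost
    everywhere on the boundary. *)
Definition boundary_condition (W : set 'rV[R]_n) k (w : form k)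
    (Dw : gradient k) (P : 'rV[R]_n -> (k.-tuple 'I_n -> R) -> Prop) : Prop :=
  exists g : form k,
    (forall J, is_trace W (fun x => w x J) (fun x j => Dw x j J)
                          (fun x => g x J)) /\
    hausdorff_measure n.-1 [set x | boundary W x /\
      ~ exists2 nu, outward_unit_normal W x nu & P nu (g x)] = 0%E.

Definition W12_T (W : set 'rV[R]_n) k (w : form k) (Dw : gradient k) : Prop :=
  W12 W w Dw /\
  boundary_condition W w Dw (fun nu a => forall J, wedge nu a J = 0).

Definition W12_N (W : set 'rV[R]_n) k (w : form k) (Dw : gradient k) : Prop :=
  W12 W w Dw /\
  boundary_condition W w Dw (fun nu a => forall J, interior_product nu a J = 0).

(** All the norms are finite on [W12]. *)
Definition gaffney_quotient (W : set 'rV[R]_n) k (w : form k)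
    (Dw : gradient k) : R :=
  fine (sqnorm_grad W Dw) /
  (fine (sqnorm_L2 W (ext_d Dw)) + fine (sqnorm_L2 W (codiff Dw)) +
   fine (sqnorm_L2 W w)).

Definition C_T (W : set 'rV[R]_n) (k : nat) : \bar R :=
  ereal_sup [set q | exists (w : form k) (Dw : gradient k),
    [/\ W12_T W w Dw, sqnorm_L2 W w != 0%E &
        q = (gaffney_quotient W w Dw)%:E]].

Definition C_N (W : set 'rV[R]_n) (k : nat) : \bar R :=
  ereal_sup [set q | exists (w : form k) (Dw : gradient k),
    [/\ W12_N W w Dw, sqnorm_L2 W w != 0%E &
        q = (gaffney_quotient W w Dw)%:E]].

End forms.

(* Main.v *)
(* Let [m = n - k + 1], [p = k - 1], and split [x - c = (y, z)] in [R^m * R^p].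
   On a thickened sphere-times-ball
     [Omega = {(|y|^2 - 2 t)^2 + t |z|^2 < t^2}],
   whose normal is [a y + b z], the field [|y|^(-m) y] is divergence and curl
   free, so that the [k]-form [|y|^(-m) y /\ dz_1 /\ ... /\ dz_p] is closed and
   co-closed, and has no tangential part on the boundary; its Hodge dual
   [|y|^(-m) (y _| dy_1 /\ ... /\ dy_m)] is the corresponding [(n - k)]-form with
   no normal part.  Both are homogeneous of degree [1 - m] in [y], so
   that their gradient is at least [|w| / |y|] by Cauchy-Schwarz.  As [|y|^2 < 3 t]
   on [Omega], the quotients are at least [1 / (3 t)]. *)
Require Import Defs.
From HB Require Import structures.
From mathcomp Require Import all_boot all_order all_algebra all_fingroup.
From mathcomp Require Import all_classical all_reals all_analysis.
From mathcomp Require Import measurable_realfun.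
From mathcomp Require Import ring lra zify.
Import Order.TTheory GRing.Theory Num.Theory.
Import numFieldTopology.Exports numFieldNormedType.Exports.
Set Implicit Arguments.
Unset Strict Implicit.
Unset Printing Implicit Defensive.
Local Open Scope classical_set_scope.
Local Open Scope ring_scope.

(** * Lebesgue measure of [R^n] *)

(** What is exploited is the lower-order term of the denominator: on a harmonic field it is all that
    is left there, and a dilation of the domain by [sqrt t] multiplies the ratio of [|grad w|^2] to
    [|w|^2] by [1 / t]. A sphere factor provides harmonic fields that meet the boundary conditions.
    The plain product of a shell and a ball has corners; the quartic rounds them off with a single
    global defining function, all of whose terms have degree 4 when [y] and [z] have degree 1 and
    [t] has degree 2, so that [t] only dilates the domain about [c]. The forms are singular only at
    [y = 0], off the closure of the domain. They are therefore their own traces, the boundary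
    condition holds at every boundary point, and the classical gradient is the weak one by
    integration by parts against test functions. Both families have the form [|y|^(-m) A(y)] with
    [A] linear, and are treated together: closedness and co-closedness follow once [y /\ A(y)] and
    [y _| A(y)] are constant multiples of [|y|^2]. *)

Lemma rV_ballP (R : realType) n (x y : 'rV[R]_n) (e : R) : 0 < e ->
  ball x e y <-> forall i, `|x ord0 i - y ord0 i| < e.
Proof.
move=> e0; split=> [[_ h] i|h]; first exact: (h ord0 i).
by split=> // i j; rewrite ord1; exact: h.
Qed.

Lemma measurable_rV_box (R : realType) n (A : 'I_n -> set (measurableTypeR R)) :
  (forall i, measurable (A i)) ->
  measurable [set x : 'rV[R]_n | forall i, A i (x ord0 i)].
Proof.
move=> mA; rewrite (_ : [set _ | _] =
    \bigcap_(i in [set: 'I_n]) ((fun v : 'rV[R]_n => v ord0 i) @^-1` A i)).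
  apply: fin_bigcap_measurable => [|i _]; first exact: finite_finset.
  by rewrite -[X in measurable X]setTI; exact: measurable_coord.
by apply/seteqP; split => [x h i _|x h i]; exact: h.
Qed.

Lemma measurable_ballR (R : realType) (x e : R) :
  measurable (ball x e : set (measurableTypeR R)).
Proof. by rewrite ball_itv; exact: measurable_itv. Qed.

Lemma measurable_rV_ball (R : realType) n (x : 'rV[R]_n) (e : R) : 0 < e ->
  measurable (ball x e).
Proof.
move=> e0; rewrite (_ : ball x e =
    [set y : 'rV[R]_n | forall i, ball (x ord0 i) e (y ord0 i)]); last first.
  by apply/seteqP; split => y /(rV_ballP _ _ e0).
by apply: (@measurable_rV_box _ _ (fun i => ball (x ord0 i) e)) => i;
  exact: measurable_ballR.
Qed.

Lemma rat_rV_dense (R : realType) n (x : 'rV[R]_n) (e : R) : 0 < e ->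
  exists q : 'rV[rat]_n, ball (map_mx ratr q : 'rV[R]_n) e x.
Proof.
move=> e0.
have [i|q qP] := @choice _ _ (fun i (q : rat) => `|ratr q - x ord0 i| < e).
  have /rat_in_itvoo[q] : x ord0 i < x ord0 i + e by rewrite ltrDl.
  rewrite in_itv/= => /andP[q1 q2]; exists q.
  by rewrite gtr0_norm ?subr_gt0// ltrBlDl.
exists (\row_i q i); apply/rV_ballP => // i.
by rewrite !mxE.
Qed.

(** The sigma-algebra is generated by the coordinates, not by the open sets. An open set is the
    countable union of the balls of rational centre and radius [1 / (k + 1)] that it contains, and
    such balls are boxes. *)
Lemma open_measurable_rV (R : realType) n (A : set 'rV[R]_n) :
  open A -> measurable A.
Proof.
move=> oA.
pose B (qk : 'rV[rat]_n * nat) : set 'rV[R]_n :=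
  if `[< ball (map_mx ratr qk.1 : 'rV[R]_n) qk.2.+1%:R^-1 `<=` A >]
  then ball (map_mx ratr qk.1 : 'rV[R]_n) qk.2.+1%:R^-1 else set0.
have -> : A = \bigcup_qk B qk.
  apply/seteqP; split => [x Ax|x [qk _]]; last first.
    by rewrite /B; case: asboolP => // h /h.
  have /nbhs_ballP[e /= e0 eA] : nbhs x A by exact: open_nbhs_nbhs.
  pose k := Num.truncn (2 / e).
  have ke : k.+1%:R^-1 < e / 2.
    by rewrite invf_plt ?posrE ?divr_gt0// invf_div truncnS_gt.
  have k0 : 0 < k.+1%:R^-1 :> R by rewrite invr_gt0.
  have [q qx] := rat_rV_dense x k0.
  exists (q, k) => //; rewrite /B/=; case: asboolP => // -[] y qy.
  apply: eA; rewrite (splitr e); apply: (@ball_triangle _ _ (map_mx ratr q : 'rV[R]_n)).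
    by apply/ball_sym; exact: le_ball (ltW ke) _ qx.
  exact: le_ball (ltW ke) _ qy.
apply: countable_bigcupT_measurable => [|qk]; first exact: countableP.
rewrite /B; case: asboolP => // _; apply: measurable_rV_ball.
by rewrite invr_gt0.
Qed.

Lemma continuous_open_measurable (R : realType) n (U : set 'rV[R]_n)
    (f : 'rV[R]_n -> R) : open U -> (forall x, U x -> {for x, continuous f}) ->
  measurable_fun U (f : _ -> measurableTypeR R).
Proof.
move=> oU cf; apply: (measurability _ (RGenOInfty.measurableE R)).
move=> _ [_ [a ->] <-]; apply: open_measurable_rV.
rewrite openE => x [Ux fx]; apply: filterI; first exact: open_nbhs_nbhs.
by apply: (cf x Ux); apply: open_nbhs_nbhs; split => //; exact: interval_open.
Qed.

Lemma lebesgue_rVS (R : realType) n (A : set 'rV[R]_n.+1) :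
  lebesgue_rV R n.+1 A =
  (@lebesgue_measure R \x lebesgue_rV R n)%E (@rV_cons R n @^-1` A).
Proof. by []. Qed.

Lemma lebesgue_rV_box (R : realType) n (A : 'I_n -> set (measurableTypeR R)) :
  (forall i, measurable (A i)) ->
  lebesgue_rV R n [set x | forall i, A i (x ord0 i)] =
  (\prod_(i < n) lebesgue_measure (A i))%E.
Proof.
elim: n A => [|n IH] A mA.
  rewrite big_ord0 (_ : [set _ | _] = setT).
    by rewrite /= diracE mem_set.
  by apply/seteqP; split => // x _ -[].
rewrite lebesgue_rVS (_ : _ @^-1` _ =
    A ord0 `*` [set y : 'rV[R]_n | forall i, A (lift ord0 i) (y ord0 i)]).
  rewrite product_measure1E//; last exact: (@measurable_rV_box _ _ (fun i => A (lift ord0 i))).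
  by rewrite (IH (fun i => A (lift ord0 i)))// big_ord_recl.
apply/seteqP; split => [[a y]/= h|[a y] /= [h1 h2] i].
  split => [|i]; first by have := h ord0; rewrite mxE unlift_none.
  by have := h (lift ord0 i); rewrite mxE liftK.
by rewrite mxE; case: unliftP => [j ->|->//]; exact: h2.
Qed.

Lemma lebesgue_rV_ball_gt0 (R : realType) n (x : 'rV[R]_n) (e : R) : 0 < e ->
  (0 < lebesgue_rV R n (ball x e))%E.
Proof.
move=> e0; rewrite (_ : ball x e =
    [set y : 'rV[R]_n | forall i, ball (x ord0 i) e (y ord0 i)]); last first.
  by apply/seteqP; split => y /(rV_ballP _ _ e0).
rewrite (@lebesgue_rV_box _ _ (fun i => ball (x ord0 i) e)); last first.
  by move=> i; exact: measurable_ballR.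
elim/big_ind : _ => // [a b|i _]; first exact: mule_gt0.
by rewrite lebesgue_measure_ball ?ltW// lte_fin pmulrn_lgt0.
Qed.

Lemma lebesgue_rV_open_gt0 (R : realType) n (A : set 'rV[R]_n) :
  open A -> A !=set0 -> (0 < lebesgue_rV R n A)%E.
Proof.
move=> oA [x Ax].
have /nbhs_ballP[e /= e0 eA] : nbhs x A by exact: open_nbhs_nbhs.
apply: lt_le_trans (lebesgue_rV_ball_gt0 x e0) _; apply: le_measure => //.
- by rewrite inE; exact: measurable_rV_ball.
- by rewrite inE; exact: open_measurable_rV.
Qed.

Lemma lebesgue_rV_ball_lty (R : realType) n (x : 'rV[R]_n) (e : R) : 0 < e ->
  (lebesgue_rV R n (ball x e) < +oo)%E.
Proof.
move=> e0; rewrite (_ : ball x e =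
    [set y : 'rV[R]_n | forall i, ball (x ord0 i) e (y ord0 i)]); last first.
  by apply/seteqP; split => y /(rV_ballP _ _ e0).
rewrite (@lebesgue_rV_box _ _ (fun i => ball (x ord0 i) e)); last first.
  by move=> i; exact: measurable_ballR.
rewrite ltey_eq; apply/orP; left.
elim/big_ind : _ => // [a b|i _]; first exact: fin_numM.
by rewrite lebesgue_measure_ball ?ltW.
Qed.

Lemma lebesgue_rV_bounded_lty (R : realType) n (A : set 'rV[R]_n) :
  measurable A -> bounded_set A -> (lebesgue_rV R n A < +oo)%E.
Proof.
move=> mA [M [_ AM]].
(* [bounded_set] bounds the norms by every number above [M], here [|M| + 1]; one more unit makes the
   inequality of the ball strict. *)
have M0 : 0 < `|M| + 2 by rewrite ltr_wpDl.
apply: le_lt_trans (lebesgue_rV_ball_lty 0 M0); apply: le_measure => //.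
- by rewrite inE.
- by rewrite inE; exact: measurable_rV_ball.
move=> x Ax; rewrite -ball_normE/= sub0r normrN.
apply: (@le_lt_trans _ _ (`|M| + 1)); last by rewrite ltrD2l ltr1n.
by apply: AM Ax; rewrite (le_lt_trans (ler_norm M))// ltrDl.
Qed.

(** * Integration by parts *)

(** Reduces directional derivatives to one real variable, for the chain rule below and for
    restricting functions to the slices of [R * R^n]. *)
Lemma is_derive1P (R : numFieldType) (V W : normedModType R) (f : V -> W)
    (x v : V) (df : W) :
  is_derive x v f df <-> is_derive (0 : R) 1 (fun h : R => f (h *: v + x)) df.
Proof.
have E : 'D_v f x = 'D_1 (fun h : R => f (h *: v + x)) 0.
  rewrite /derive; set g1 := fun h => h^-1 *: _; set g2 := fun h => h^-1 *: _.
  suff -> : g1 = g2 by [].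
  by rewrite funeqE /g1 /g2 => h /=; rewrite addr0 scale0r add0r [_%:A]mulr1.
split=> -[d e]; apply: DeriveDef.
- by move/derivable1P : d.
- by rewrite -E.
- by apply/derivable1P.
- by rewrite E.
Qed.

Lemma is_derive_comp1 (R : realFieldType) (V : normedModType R) (h : R -> R)
    (f : V -> R) (x v : V) (df dh : R) :
  is_derive x v f df -> is_derive (f x) 1 h dh ->
  is_derive x v (h \o f) (dh * df).
Proof.
move=> /is_derive1P ff hh; apply/is_derive1P.
pose g := fun t : R => f (t *: v + x).
have hh' : is_derive (g 0) 1 h dh by rewrite /g scale0r add0r.
have [a b] := hh'; have [c d] := ff.
apply: DeriveDef.
  apply/derivable1_diffP; apply: (@differentiable_comp _ _ _ _ g h).
    exact/derivable1_diffP.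
  exact/derivable1_diffP.
have := @derive1_comp _ g h 0 c a; rewrite !derive1E => ->.
by rewrite b d.
Qed.

Lemma is_derive_coord (R : realFieldType) n (j : 'I_n) (x v : 'rV[R]_n) :
  is_derive x v (fun y : 'rV[R]_n => y ord0 j) (v ord0 j).
Proof.
apply/is_derive1P; rewrite (_ : (fun _ => _) =
  (fun h : R => v ord0 j * h + x ord0 j)); last first.
  by apply/funext => h; rewrite !mxE mulrC.
rewrite -[X in is_derive _ _ _ X](_ : v ord0 j *: 1 + 0 = _); last first.
  by rewrite addr0 [_%:A]mulr1.
by apply: is_deriveD; apply: (@is_deriveZ _ _ _ id).
Qed.

Lemma continuous_rV (R : realType) (T : topologicalType) n (f : T -> 'rV[R]_n)
    (x : T) : (forall i, continuous_at x (fun y => f y ord0 i)) ->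
  {for x, continuous f}.
Proof.
move=> cf; apply/cvg_ballP => e e0.
have : \forall z \near x, forall i, ball (f x ord0 i) e (f z ord0 i).
  by apply: filter_forall => j; have /cvg_ballP := cf j; exact.
by apply: filterS => y h; apply/rV_ballP.
Qed.

Lemma compact_coord_bounded (R : realType) n (K : set 'rV[R]_n) (i : 'I_n) :
  compact K -> exists2 B : R, 0 < B & forall x, K x -> `|x ord0 i| < B.
Proof.
move=> cK.
have /compact_bounded[M [_ KM]] : compact ((fun x : 'rV[R]_n => x ord0 i) @` K).
  apply: continuous_compact => //; apply: continuous_subspaceT => x.
  exact: coord_continuous.
exists (`|M| + 2) => [|x Kx]; first by rewrite ltr_wpDl.
apply: (@le_lt_trans _ _ (`|M| + 1)); last by rewrite ltrD2l ltr1n.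
apply: (KM (`|M| + 1)); first by rewrite (le_lt_trans (ler_norm M))// ltrDl.
by exists x.
Qed.

Lemma is_derive_outside_support (R : numFieldType) (V W : normedModType R)
    (f : V -> W) (K : set V) (x v : V) : closed K ->
  (forall y, ~ K y -> f y = 0) -> ~ K x -> is_derive x v f 0.
Proof.
move=> cK f0 Kx; apply: (@near_eq_is_derive _ _ _ (cst 0)).
have : nbhs x (~` K) by apply: open_nbhs_nbhs; split => //; exact: closed_openC.
by apply: filterS => y /f0 ->.
Qed.

Lemma continuous_compact_support_integrable (R : realType) n
    (f : 'rV[R]_n -> R) (K : set 'rV[R]_n) :
  compact K -> continuous f -> (forall x, ~ K x -> f x = 0) ->
  (lebesgue_rV R n).-integrable setT (EFin \o f).
Proof.
move=> cK cf f0.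
have mK : measurable K.
  rewrite -[K]setCK; apply: measurableC; apply: open_measurable_rV.
  apply: closed_openC; exact: (compact_closed (@norm_hausdorff _ _) cK).
rewrite (_ : EFin \o f = (EFin \o f) \_ K); last first.
  apply/funext => x; rewrite patchE; case: ifPn => //.
  by rewrite notin_setE => /f0 /= ->.
apply: (integrable_mkcond (EFin \o f) mK).1; apply: (@measurable_bounded_integrable _ _ _ (lebesgue_rV R n) f K) => //.
- by apply: lebesgue_rV_bounded_lty => //; exact: compact_bounded.
- apply: (@measurable_funS _ _ _ _ setT) => //.
  apply: continuous_open_measurable; first exact: openT.
  by move=> x _; exact: cf.
- have : compact (f @` K).
    by apply: continuous_compact => //; exact: continuous_subspaceT.
  by move=> /compact_bounded; rewrite /bounded_near => -[M [Mr KM]];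
    exists M; split => // y My x Kx; apply: (KM y My); exists x.
Qed.

(** Both boundary terms of the fundamental theorem of calculus on [[- B, B]] vanish, since the
    hypothesis on [F] includes [|x| = B]. *)
Lemma integral_derive_compact_support (R : realType) (F G : R -> R) (B : R) :
  0 < B -> (forall x : R, is_derive x 1 F (G x)) -> continuous G ->
  (forall x, B <= `|x| -> F x = 0) ->
  (\int[lebesgue_measure]_x (G x)%:E = 0)%E.
Proof.
move=> B0 dF cG F0.
have NB : - B < B by rewrite gtrN.
have G0 x : ~ `[- B, B]%classic x -> G x = 0.
  rewrite /= in_itv/= -ler_norml => /negP; rewrite -ltNge => Bx.
  have [_ <-] := dF x.
  rewrite (@near_eq_derive _ _ _ _ (cst 0)) ?derive_cst//.
  have : nbhs x [set y : R | B < `|y|].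
    apply: open_nbhs_nbhs; split => //.
    apply: (@open_comp _ _ (fun y : R => `|y|) [set y | B < y]).
      by move=> y _; exact: norm_continuous.
    exact: open_gt.
  by apply: filterS => y /= By; rewrite F0// ltW.
have cF : continuous F.
  by move=> x; apply/differentiable_continuous/derivable1_diffP; case: (dF x).
transitivity (\int[lebesgue_measure]_(x in `[(- B)%R, B]) (G x)%:E)%E.
  rewrite [RHS]integral_mkcond; congr (integral _ _ _); apply/funext => x.
  rewrite patchE; case: ifPn => //.
  by rewrite notin_setE => /G0 ->.
rewrite (@continuous_FTC2 _ _ F)//.
- by rewrite !F0 ?normrN ?gtr0_norm// subee.
- exact: continuous_subspaceT.
- split.
  + by move=> x _; case: (dF x).
  + by apply: cvg_at_right_filter; exact: cF.
  + by apply: cvg_at_left_filter; exact: cF.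
- by move=> x _; rewrite derive1E; case: (dF x).
Qed.

Lemma integral_rVS (R : realType) n (f : 'rV[R]_n.+1 -> R) :
  (lebesgue_rV R n.+1).-integrable setT (EFin \o f) ->
  (@lebesgue_measure R \x lebesgue_rV R n)%E.-integrable setT
     (fun p => (f (rV_cons p))%:E) /\
  (\int[lebesgue_rV R n.+1]_x (f x)%:E =
   \int[(@lebesgue_measure R \x lebesgue_rV R n)%E]_p (f (rV_cons p))%:E)%E.
Proof.
move=> /integrableP[mf intf].
have ic : (@lebesgue_measure R \x lebesgue_rV R n)%E.-integrable setT
     (fun p => (f (rV_cons p))%:E).
  apply/integrableP; split.
    exact: (measurableT_comp mf (@measurable_rV_cons R n)).
  apply: le_lt_trans intf.
  rewrite [leRHS](@ge0_integral_pushforward _ _ _ _ _ _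
    (@measurable_rV_cons R n) (@lebesgue_measure R \x lebesgue_rV R n)%E)//.
  by apply: measurableT_comp => //; exact: measurableT_comp.
split => //.
by rewrite [LHS](@integral_pushforward _ _ _ _ _ _
    (@measurable_rV_cons R n) (@lebesgue_measure R \x lebesgue_rV R n)%E).
Qed.

Lemma rV_consDl (R : realType) n (h a : R) (y : 'rV[R]_n) :
  rV_cons (h * 1 + a, y) = h *: delta_mx ord0 ord0 + rV_cons (a, y).
Proof.
apply/rowP => i; rewrite !mxE; case: unliftP => [j ->|->] /=.
  by rewrite ?eqxx/= ?mulr0 ?add0r.
by rewrite ?eqxx.
Qed.

Lemma rV_consDr (R : realType) n (h a : R) (y : 'rV[R]_n) (j : 'I_n) :
  rV_cons (a, h *: delta_mx ord0 j + y) =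
  h *: delta_mx ord0 (lift ord0 j) + rV_cons (a, y).
Proof.
apply/rowP => i; rewrite !mxE; case: unliftP => [k ->|->] /=.
  by rewrite !mxE !eqxx/= (inj_eq lift_inj).
by rewrite ?andbF ?(negbTE (neq_lift _ _)) ?mulr0 ?add0r.
Qed.

Lemma continuous_rV_consl (R : realType) n (y : 'rV[R]_n) :
  continuous (fun a : R => rV_cons (a, y)).
Proof.
move=> a; apply: continuous_rV => i; case: (unliftP ord0 i) => [j|] ->.
  by under eq_fun do rewrite mxE liftK; exact: cvg_cst.
by under eq_fun do rewrite mxE unlift_none; exact: cvg_id.
Qed.

Lemma continuous_rV_consr (R : realType) n (a : R) :
  continuous (fun y : 'rV[R]_n => rV_cons (a, y)).
Proof.
move=> y; apply: continuous_rV => i; case: (unliftP ord0 i) => [j|] ->.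
  by under eq_fun do rewrite mxE liftK; exact: coord_continuous.
by under eq_fun do rewrite mxE unlift_none; exact: cst_continuous.
Qed.

(** Fubini, in the order that puts direction [i] in the inner integral: the one-variable case
    applies if [i] is the first coordinate, the induction hypothesis on each slice otherwise. The
    projection of [K] is a compact support valid for all slices. *)
Lemma integral_partial_compact_support (R : realType) n (i : 'I_n)
    (f g : 'rV[R]_n -> R) (K : set 'rV[R]_n) :
  compact K -> (forall x, is_derive x (delta_mx ord0 i : 'rV_n) f (g x)) ->
  continuous g -> (forall x, ~ K x -> f x = 0) ->
  (\int[lebesgue_rV R n]_x (g x)%:E = 0)%E.
Proof.
elim: n => [|n IH] in i f g K * => cK df cg f0; first by case: i df => [[]].
have clK : closed K by exact: (compact_closed (@norm_hausdorff _ _) cK).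
have g0 x : ~ K x -> g x = 0.
  move=> Kx; have [_ <-] := df x.
  by have [_ ->] := is_derive_outside_support (delta_mx ord0 i) clK f0 Kx.
have [ic ->] := integral_rVS (continuous_compact_support_integrable cK cg g0).
case: (unliftP ord0 i) df => [j|] ->{i} df.
  rewrite -integral12_prod_meas1//; apply: integral0_eq => a _.
  rewrite /fubini_F/=.
  pose tl (x : 'rV[R]_n.+1) : 'rV[R]_n := (rV_uncons x).2.
  apply: (IH j (fun y => f (rV_cons (a, y))) _ (tl @` K)) => [|y|y|y Ky].
  - apply: continuous_compact => //; apply: continuous_subspaceT => x.
    apply: continuous_rV => l; rewrite /tl/=.
    by under eq_fun do rewrite mxE; exact: coord_continuous.
  - apply/is_derive1P; under eq_fun do rewrite rV_consDr.
    exact: (is_derive1P f _ _ _).1 (df _).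
  - apply: (@continuous_comp _ _ _ (fun y : 'rV[R]_n => rV_cons (a, y)) g).
      exact: continuous_rV_consr.
    exact: cg.
  - apply: f0 => Kay; apply: Ky; exists (rV_cons (a, y)) => //.
    by rewrite /tl rV_consK.
rewrite -integral21_prod_meas1//; apply: integral0_eq => y _.
rewrite /fubini_G/=.
have [B B0 KB] := compact_coord_bounded ord0 cK.
apply: (@integral_derive_compact_support _ (fun a => f (rV_cons (a, y))) _ B)
  => // [a|a|a Ba].
- apply/is_derive1P; under eq_fun do rewrite [_ *: _]/(_ * _) rV_consDl.
  exact: (is_derive1P f _ _ _).1 (df _).
- apply: (@continuous_comp _ _ _ (fun a : R => rV_cons (a, y)) g).
    exact: continuous_rV_consl.
  exact: cg.
- apply: f0 => /KB; rewrite mxE unlift_none/=.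
  by rewrite ltNge Ba.
Qed.

(* Off the support of [phi] the product [u * phi] vanishes, so that the
   derivability of [u] is only needed on [U]. *)
Lemma classical_weak_partial (R : realType) n (W U : set 'rV[R]_n) (i : 'I_n)
    (u v : 'rV[R]_n -> R) :
  open U -> W `<=` U ->
  (forall x, U x -> {for x, continuous u}) ->
  (forall x, U x -> {for x, continuous v}) ->
  (forall x, U x -> is_derive x (delta_mx ord0 i : 'rV_n) u (v x)) ->
  weak_partial W i u v.
Proof.
move=> oU WU cu cv du phi [sphi [K [cK KW phi0]]].
have clK : closed K by exact: (compact_closed (@norm_hausdorff _ _) cK).
have cphi : continuous phi by have [+ _] := sphi 0%N; move=> + x; exact.
have dphi x : is_derive x (delta_mx ord0 i : 'rV_n) phi (partial i phi x).
  by have [_ /(_ i)[+ _]] := sphi 1%N; move=> /(_ x I) ?; exact: derivableP.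
have cdphi : continuous (partial i phi).
  by have [_ /(_ i)[_ [+ _]]] := sphi 1%N; move=> + x; exact.
have dphi0 x : ~ K x -> partial i phi x = 0.
  move=> Kx; have [_ <-] := dphi x.
  by have [_ ->] := is_derive_outside_support (delta_mx ord0 i) clK phi0 Kx.
have cprod (a b : 'rV[R]_n -> R) : (forall x, U x -> {for x, continuous a}) ->
    continuous b -> (forall x, ~ K x -> b x = 0) ->
    continuous (fun x => a x * b x).
  move=> ca cb b0 x; have [Kx|Kx] := pselect (K x).
    by apply: continuousM; [exact/ca/WU/KW|exact: cb].
  have : nbhs x (~` K) by apply: open_nbhs_nbhs; split => //; exact: closed_openC.
  move=> nK; rewrite /continuous_at b0// mulr0.
  apply: (@cvg_near_cst _ R (0 : R) _ (nbhs x)); apply: filterS nK => y Ky.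
  by rewrite b0// mulr0.
have iprod (a b : 'rV[R]_n -> R) (ca : forall x, U x -> {for x, continuous a})
    (cb : continuous b) (b0 : forall x, ~ K x -> b x = 0) :
    (lebesgue_rV R n).-integrable setT (EFin \o (fun x => a x * b x)).
  apply: (continuous_compact_support_integrable cK); first exact: cprod.
  by move=> x /b0 ->; rewrite mulr0.
have restrictW (a b : 'rV[R]_n -> R) : (forall x, ~ K x -> b x = 0) ->
    \int[lebesgue_rV R n]_(x in W) (a x * b x) =
    \int[lebesgue_rV R n]_x (a x * b x).
  move=> b0; rewrite /Rintegral [in LHS]integral_mkcond; congr (fine _).
  congr (integral _ _ _); apply/funext => x; rewrite patchE; case: ifPn => //.
  rewrite notin_setE => Wx; rewrite b0 ?mulr0// => Kx; exact/Wx/KW.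
(* On one side, the two integrands add up to the [i]-th partial derivative of [u * phi], which has
   compact support. *)
rewrite !restrictW//; apply/eqP; rewrite -addr_eq0.
rewrite -RintegralD//; [|exact: iprod..].
rewrite /Rintegral; suff -> :
  (\int[lebesgue_rV R n]_x (u x * partial i phi x + v x * phi x)%:E = 0)%E by [].
apply: (@integral_partial_compact_support _ _ i (fun x => u x * phi x) _ K)
  => // [x|x|x Kx].
- have [Kx|Kx] := pselect (K x); last first.
    rewrite phi0// dphi0// !mulr0 addr0.
    apply: (is_derive_outside_support _ clK) => // y /phi0 ->.
    by rewrite mulr0.
  have := is_deriveM (du x (WU _ (KW _ Kx))) (dphi x).
  by rewrite [v x * _]mulrC.
- exact: (cvgD (cprod _ _ cu cdphi dphi0 x) (cprod _ _ cv cphi phi0 x)).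
- by rewrite phi0// mulr0.
Qed.

(** * Algebra of the two families of covectors *)

Section stack.
Context {R : comNzRingType}.

Definition stack {k n} (r : 'rV[R]_n) (N : 'M[R]_(k, n)) : 'M[R]_(k.+1, n) :=
  \matrix_(a, b) if unlift ord0 a is Some l then N l b else r ord0 b.

Lemma det_stack k (r : 'rV[R]_k.+1) (N : 'M[R]_(k, k.+1)) :
  \det (stack r N) = \sum_j r ord0 j * ((-1) ^+ j * \det (col' j N)).
Proof.
rewrite (expand_det_row _ ord0); apply: eq_bigr => j _.
rewrite mxE unlift_none /cofactor add0n; congr (_ * (_ * \det _)).
by apply/matrixP => a b; rewrite !mxE liftK.
Qed.

Lemma det_stack_row k (r : 'rV[R]_k.+1) (N : 'M[R]_(k, k.+1)) (l : 'I_k) :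
  r = row l N -> \det (stack r N) = 0.
Proof.
move=> rN; apply: (determinant_alternate (neq_lift ord0 l)) => b.
by rewrite !mxE unlift_none liftK rN mxE.
Qed.

Lemma col'_stack k n (r : 'rV[R]_n) (N : 'M[R]_(k, n)) j :
  col' j (stack r N) = stack (col' j r) (col' j N).
Proof.
by apply/matrixP => a b; rewrite !mxE; case: unliftP => [l|] _; rewrite ?mxE.
Qed.

Lemma det_stack2_linear k (r s s' : 'rV[R]_k.+2) (N : 'M[R]_(k, k.+2)) c c' :
  \det (stack r (stack (c *: s + c' *: s') N)) =
  c * \det (stack r (stack s N)) + c' * \det (stack r (stack s' N)).
Proof.
have eq_row' (t t' : 'rV[R]_k.+2) : row' (lift ord0 ord0) (stack r (stack t N)) =
    row' (lift ord0 ord0) (stack r (stack t' N)).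
  apply/matrixP => a b; rewrite !mxE; case: unliftP => [l|//] El.
  rewrite !mxE; case: unliftP => [//|] El'.
  by move: (neq_lift (lift ord0 ord0) a); rewrite El El' eqxx.
apply: (determinant_multilinear (i0 := lift ord0 ord0)); [|exact: eq_row'..].
by apply/rowP => b; rewrite !mxE liftK/= !mxE unlift_none.
Qed.

Lemma det_stack2_sum (I : finType) k (r : 'rV[R]_k.+2) (N : 'M[R]_(k, k.+2))
    (c : I -> R) (s : I -> 'rV[R]_k.+2) :
  \det (stack r (stack (\sum_i c i *: s i) N)) =
  \sum_i c i * \det (stack r (stack (s i) N)).
Proof.
elim/big_rec2 : _ => [|i x y _ <-].
  by have := det_stack2_linear r 0 0 N 0 0; rewrite !scale0r addr0 !mul0r addr0.
by rewrite -{1}[y]scale1r det_stack2_linear mul1r.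
Qed.

Lemma det_stackZ k (r : 'rV[R]_k.+1) (N : 'M[R]_(k, k.+1)) c :
  \det (stack (c *: r) N) = c * \det (stack r N).
Proof.
rewrite !det_stack mulr_sumr; apply: eq_bigr => j _.
by rewrite mxE mulrA.
Qed.

Lemma det_stackD k (r s : 'rV[R]_k.+1) (N : 'M[R]_(k, k.+1)) :
  \det (stack (r + s) N) = \det (stack r N) + \det (stack s N).
Proof.
rewrite !det_stack -big_split; apply: eq_bigr => j _.
by rewrite mxE mulrDl.
Qed.

Lemma det_stack_sum (I : finType) k (r : I -> 'rV[R]_k.+1)
    (N : 'M[R]_(k, k.+1)) (c : I -> R) :
  \det (stack (\sum_i c i *: r i) N) = \sum_i c i * \det (stack (r i) N).
Proof.
elim/big_rec2 : _ => [|i x y _ <-].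
  by rewrite det_stack big1// => j _; rewrite mxE mul0r.
by rewrite det_stackD det_stackZ.
Qed.

Lemma det_stack_row_perm k (r : 'rV[R]_k.+1) (N : 'M[R]_(k, k.+1)) (s : 'S_k) :
  \det (stack r (row_perm s N)) = (-1) ^+ s * \det (stack r N).
Proof.
rewrite !det_stack mulr_sumr; apply: eq_bigr => j _.
have -> : col' j (row_perm s N) = row_perm s (col' j N).
  by apply/matrixP => a b; rewrite !mxE.
by rewrite row_permE det_mulmx det_perm [RHS]mulrCA; congr (_ * _); exact: mulrCA.
Qed.

Lemma det_stack_col0 k (r : 'rV[R]_k.+1) (N : 'M[R]_(k, k.+1)) :
  (forall l, N l ord0 = 0) -> \det (stack r N) = r ord0 ord0 * \det (col' ord0 N).
Proof.
move=> N0; rewrite (expand_det_col _ ord0) big_ord_recl big1 => [|a _].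
  rewrite addr0 mxE unlift_none /cofactor addn0 expr0 mul1r; congr (_ * \det _).
  by apply/matrixP => a b; rewrite !mxE liftK.
by rewrite mxE liftK N0 mul0r.
Qed.

End stack.

(** * The tangential and normal families of covectors *)

Section covectors.
Context {R : realType}.

Definition pad {m} p (y : 'rV[R]_m) : 'rV[R]_(m + p) := row_mx y 0.

(* The two families of covectors are linear in [y]; [tangential y] is
   [y /\ e_m /\ ... /\ e_(m + p - 1)]. *)
Definition tangential_mx {m p k} (J : k.-tuple 'I_(m + p)) : 'M[R]_(p, k) :=
  \matrix_(l, b) (rshift m l == tnth J b)%:R.

Definition comps {n k} (v : 'rV[R]_n) (J : k.-tuple 'I_n) : 'rV[R]_k :=
  \row_b v ord0 (tnth J b).

Definition tangential {m p} (y : 'rV[R]_m) (J : p.+1.-tuple 'I_(m + p)) : R :=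
  \det (stack (comps (pad p y) J) (tangential_mx J)).

(* The contraction of [e_0 /\ ... /\ e_(m - 1)] with [y], for [m = q.+1]. *)
Definition normal_mx {m p k} (J : k.-tuple 'I_(m + p)) : 'M[R]_(k, m) :=
  \matrix_(l, b) (tnth J l == lshift p b)%:R.

Definition normal {q p} (y : 'rV[R]_q.+1) (J : q.-tuple 'I_(q.+1 + p)) : R :=
  \det (stack y (normal_mx J)).

Definition dotr {m} (x y : 'rV[R]_m) : R := \sum_b x ord0 b * y ord0 b.

Definition linear_covector {m n k} (A : 'rV[R]_m -> k.-tuple 'I_n -> R) : Prop :=
  forall (y : 'rV[R]_m) J, A y J = \sum_b y ord0 b * A (delta_mx ord0 b) J.

Lemma padl {m p} (y : 'rV[R]_m) b : pad p y ord0 (lshift p b) = y ord0 b.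
Proof. exact: row_mxEl. Qed.

Lemma padr {m p} (y : 'rV[R]_m) (l : 'I_p) : pad p y ord0 (rshift m l) = 0.
Proof. by rewrite /pad row_mxEr mxE. Qed.

Lemma row_sum_deltaE m (y : 'rV[R]_m) :
  y = \sum_b y ord0 b *: (delta_mx ord0 b : 'rV_m).
Proof. by rewrite {1}[y]matrix_sum_delta big_ord1. Qed.

Lemma comps_pad_linear {m p k} (y : 'rV[R]_m) (J : k.-tuple 'I_(m + p)) :
  comps (pad p y) J = \sum_b y ord0 b *: comps (pad p (delta_mx ord0 b)) J.
Proof.
apply/rowP => i; rewrite summxE mxE.
case: (split_ordP (tnth J i)) => j Ej.
  rewrite Ej padl {1}[y]row_sum_deltaE summxE; apply: eq_bigr => b _.
  by rewrite 2![in RHS]mxE Ej padl [in LHS]mxE.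
by rewrite Ej padr big1// => b _; rewrite 2!mxE Ej padr mulr0.
Qed.

Lemma tangential_linear {m p} : linear_covector (@tangential m p).
Proof. by move=> y J; rewrite /tangential comps_pad_linear det_stack_sum. Qed.

Lemma normal_linear {q p} : linear_covector (@normal q p).
Proof. by move=> y J; rewrite /normal {1}[y]row_sum_deltaE det_stack_sum. Qed.

Lemma tangential_alternating {m p} (y : 'rV[R]_m) :
  alternating_covector (@tangential m p y).
Proof.
move=> s J; rewrite /tangential.
set M := stack (comps _ J) _.
rewrite (_ : stack _ _ = col_perm s M).
  by rewrite col_permE det_mulmx det_perm odd_permV mulrC.
by apply/matrixP => a b; rewrite !mxE; case: unliftP => [l|] _;
  rewrite ?mxE tnth_mktuple ?mxE.
Qed.

(** Here [J] indexes the rows below the first, whereas it indexes the columns for [tangential]. *)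
Lemma normal_alternating {q p} (y : 'rV[R]_q.+1) :
  alternating_covector (@normal q p y).
Proof.
move=> s J; rewrite /normal -det_stack_row_perm; congr (\det (stack _ _)).
by apply/matrixP => a b; rewrite !mxE tnth_mktuple.
Qed.

Lemma wedge_tangential {m p} (v : 'rV[R]_(m + p)) (y : 'rV[R]_m) K :
  wedge v (tangential y) K =
  \det (stack (comps v K) (stack (comps (pad p y) K) (tangential_mx K))).
Proof.
rewrite det_stack /wedge /Defs.skew; apply: eq_bigr => l _.
rewrite mxE mulrCA; do 2 congr (_ * _); rewrite col'_stack.
by congr (\det (stack _ _)); apply/matrixP => a b; rewrite !mxE tnth_mktuple.
Qed.

(* [row_mx (c *: y) z] is the form of the normal to the boundary. *)
Lemma wedge_tangential_eq0 {m p} (c : R) (y : 'rV[R]_m) (z : 'rV[R]_p) K :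
  wedge (row_mx (c *: y) z) (tangential y) K = 0.
Proof.
rewrite wedge_tangential.
(* The top row is a combination of the rows below it, which are the components of [y] and of the [z]
   directions. *)
rewrite (_ : comps _ K = c *: comps (pad p y) K +
    \sum_l z ord0 l *: row l (tangential_mx K)); last first.
  apply/rowP => i; rewrite mxE [RHS]mxE [(c *: comps _ _) _ _]mxE [comps (pad p y) K _ _]mxE.
  rewrite summxE; case: (split_ordP (tnth K i)) => j Ej.
    rewrite Ej row_mxEl padl mxE big1 ?addr0// => l _.
    by rewrite !mxE Ej eq_rlshift mulr0.
  rewrite Ej row_mxEr padr mulr0 add0r (bigD1 j)//= big1 ?addr0.
    by rewrite !mxE Ej eqxx mulr1.
  move=> l lj; rewrite !mxE Ej (inj_eq (@rshift_inj _ _)) (negbTE lj).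
  by rewrite mulr0.
rewrite det_stackD det_stackZ det_stack_sum.
rewrite (@det_stack_row _ _ _ _ ord0); last first.
  by apply/rowP => b; rewrite [RHS]mxE [RHS]mxE unlift_none.
rewrite mulr0 add0r big1// => l _.
rewrite (@det_stack_row _ _ _ _ (lift ord0 l)) ?mulr0//.
by apply/rowP => b; rewrite [RHS]mxE [RHS]mxE liftK mxE.
Qed.

Lemma tangential_cons {m p} (y : 'rV[R]_m) b (J : p.-tuple 'I_(m + p)) :
  tangential y [tuple of lshift p b :: J] =
  y ord0 b * \det (tangential_mx J : 'M[R]_p).
Proof.
rewrite /tangential det_stack_col0 => [|l].
  rewrite mxE tnth0 padl; congr (_ * \det _).
  by apply/matrixP => a j; rewrite !mxE tnthS.
by rewrite mxE tnth0 eq_rlshift.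
Qed.

Lemma interior_tangential {m p} (y : 'rV[R]_m) (J : p.-tuple 'I_(m + p)) :
  @interior_product _ _ p.+1 (pad p y) (tangential y) J =
  \det (tangential_mx J : 'M[R]_p) * dotr y y.
Proof.
rewrite /interior_product/= big_split_ord/= [X in _ + X]big1 ?addr0 => [|l _].
  rewrite /dotr mulr_sumr; apply: eq_bigr => b _.
  by rewrite padl tangential_cons; ring.
by rewrite padr mul0r.
Qed.

(** The contraction fills the second row of the determinant, and the [z] part of [v] is lost because
    the rows only record [y] directions. A multiple of [y] then repeats the first row. *)
Lemma interior_normal {q p} (v : 'rV[R]_(q.+2 + p)) (y : 'rV[R]_q.+2) J :
  @interior_product _ _ q.+1 v (normal y) J =
  \det (stack y (stack (lsubmx v) (normal_mx J))).
Proof.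
transitivity (\det (stack y (stack (\sum_j v ord0 j *:
    (\row_b (j == lshift p b)%:R)) (normal_mx J)))).
  rewrite det_stack2_sum /interior_product/=; apply: eq_bigr => j _.
  congr (_ * \det (stack _ _)); apply/matrixP => a b; rewrite !mxE.
  by case: unliftP => [l ->|->]; rewrite ?mxE ?tnthS ?tnth0 ?mxE.
congr (\det (stack _ (stack _ _))); apply/rowP => b; rewrite summxE mxE.
rewrite (bigD1 (lshift p b))//= big1 ?addr0 => [|j jb].
  by rewrite !mxE eqxx mulr1.
by rewrite !mxE (negbTE jb) mulr0.
Qed.

Lemma interior_normal_eq0 {q p} (c : R) (y : 'rV[R]_q.+2) (z : 'rV[R]_p) J :
  @interior_product _ _ q.+1 (row_mx (c *: y) z) (normal y) J = 0.
Proof.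
rewrite interior_normal row_mxKl.
have := det_stack2_linear y y 0 (normal_mx J) c 0.
rewrite scale0r addr0 mul0r addr0 => ->; rewrite (@det_stack_row _ _ _ _ ord0) ?mulr0//.
by apply/rowP => b; rewrite !mxE unlift_none.
Qed.

(** With [X] the matrix of [K], the components of [y] along [K] are [X y], and the signed values of
    [normal y] on [K] with one index removed are the cofactor combinations [y adj(X)]. Their pairing
    is [y adj(X) X y], and [adj(X) X] is the scalar matrix [\det X]. *)
Lemma wedge_normal {q p} (y : 'rV[R]_q.+1) (K : q.+1.-tuple 'I_(q.+1 + p)) :
  wedge (pad p y) (normal y) K = \det (normal_mx K : 'M[R]_q.+1) * dotr y y.
Proof.
set X : 'M[R]_q.+1 := normal_mx K.
have padK l : pad p y ord0 (tnth K l) = \sum_b y ord0 b * X l b.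
  case: (split_ordP (tnth K l)) => j Ej.
    rewrite Ej padl (bigD1 j)//= big1 ?addr0 => [|b bj].
      by rewrite mxE Ej eqxx mulr1.
    by rewrite mxE Ej (inj_eq (@lshift_inj _ _)) eq_sym (negbTE bj) mulr0.
  by rewrite Ej padr big1// => b _; rewrite mxE Ej eq_rlshift mulr0.
have normalK (l : 'I_q.+1) : (-1) ^+ l * normal y [tuple tnth K (lift l i) | i < q] =
    \sum_b y ord0 b * (\adj X) b l.
  rewrite /normal det_stack mulr_sumr; apply: eq_bigr => b _.
  rewrite mxE /cofactor exprD mulrCA -!mulrA; do 3 congr (_ * _).
  by congr (\det _); apply/matrixP => i j; rewrite !mxE tnth_mktuple ?mxE.
transitivity (\sum_b \sum_j y ord0 b * y ord0 j * (\adj X *m X) j b).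
  rewrite /wedge /Defs.skew/=.
  under eq_bigr do rewrite mulrCA normalK padK big_distrlr/=.
  rewrite exchange_big/=; apply: eq_bigr => b _.
  rewrite exchange_big/=; apply: eq_bigr => j _.
  by rewrite mxE mulr_sumr; apply: eq_bigr => l _; ring.
rewrite mul_adj_mx /dotr mulr_sumr; apply: eq_bigr => b _.
rewrite (bigD1 b)//= big1 ?addr0 => [|j jb].
  by rewrite mxE eqxx mulr1n; ring.
by rewrite mxE (negbTE jb) mulr0n mulr0.
Qed.

(** [sqnorm] only sees increasing tuples, so a component that does not vanish identically has to be
    exhibited on one: the first [y] index followed by all the [z] indices. *)
Lemma tangential_neq0 {q p} : exists2 J : p.+1.-tuple 'I_(q.+1 + p),
  increasing J & forall y : 'rV[R]_q.+1, tangential y J = y ord0 ord0.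
Proof.
exists [tuple of lshift p ord0 :: [tuple rshift q.+1 l | l < p]].
  rewrite /increasing/= -map_comp (eq_map (g := addn q.+1 \o val))//.
  rewrite map_comp val_enum_ord -iotaDl addn0.
  rewrite (path_sortedE ltn_trans) iota_ltn_sorted andbT.
  by apply/allP => i; rewrite mem_iota => /andP[/(leq_trans _) ->].
move=> y; rewrite tangential_cons (_ : tangential_mx _ = 1%:M) ?det1 ?mulr1//.
apply/matrixP => a b; rewrite !mxE tnth_mktuple.
by rewrite (inj_eq (@rshift_inj _ _)).
Qed.

Lemma normal_neq0 {q p} : exists2 J : q.-tuple 'I_(q.+1 + p),
  increasing J & forall y : 'rV[R]_q.+1, normal y J = y ord0 ord0.
Proof.
(* All the [y] indices but the first: below [y] the determinant then has the rows
   [e_1, ..., e_q]. *)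
exists [tuple lshift p (lift ord0 l) | l < q].
  rewrite /increasing/= -map_comp (eq_map (g := addn 1 \o val))//.
  by rewrite map_comp val_enum_ord -iotaDl addn0 iota_ltn_sorted.
move=> y; rewrite /normal det_stack_col0 => [|l].
  set X := col' _ _; suff -> : X = 1%:M by rewrite det1 mulr1.
  apply/matrixP => a b; rewrite !mxE tnth_mktuple.
  by rewrite (inj_eq (@lshift_inj _ _)) (inj_eq lift_inj).
by rewrite mxE tnth_mktuple (inj_eq (@lshift_inj _ _)) eq_sym (negbTE (neq_lift _ _)).
Qed.

End covectors.

(** * Calculus of the radial fields *)

Lemma Cr_cst (R : realType) n r (U : set 'rV[R]_n) (a : R) :
  Cr r U (fun=> a).
Proof.
elim: r a => [|r IH] a; first by split => // x _; exact: cst_continuous.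
split => [x _|i]; first exact: cst_continuous.
split => [x _|]; first exact: derivable_cst.
rewrite (_ : partial i _ = fun=> 0); first exact: IH.
by apply/funext => x; rewrite /partial derive_cst.
Qed.

Lemma CrW (R : realType) n r (U : set 'rV[R]_n) (f : 'rV[R]_n -> R) :
  Cr r.+1 U f -> Cr r U f.
Proof.
elim: r f => [|r IH] f [cf df]; first by split.
split => // i.
by have [d1 d2] := df i; split => //; exact: IH.
Qed.

Section Cr_polynomial.
Context {R : realType} {n : nat}.
Implicit Types f g : 'rV[R]_n -> R.

Lemma CrD r f g :
  Cr r setT f -> Cr r setT g -> Cr r setT (fun x => f x + g x).
Proof.
elim: r f g => [|r IH] f g [cf df] [cg dg].
  by split => // x _; apply: continuousD; [exact: cf|exact: cg].
split => [x _|i]; first by apply: continuousD; [exact: cf|exact: cg].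
have [df1 df2] := df i; have [dg1 dg2] := dg i.
split => [x _|]; first by apply: derivableD; [exact: df1|exact: dg1].
rewrite (_ : partial i _ = fun x => partial i f x + partial i g x).
  exact: IH.
by apply/funext => x; rewrite /partial deriveD//; [exact: df1|exact: dg1].
Qed.

Lemma CrM r f g :
  Cr r setT f -> Cr r setT g -> Cr r setT (fun x => f x * g x).
Proof.
elim: r f g => [|r IH] f g Hf Hg; have [cf df] := Hf; have [cg dg] := Hg.
  by split => // x _; apply: continuousM; [exact: cf|exact: cg].
split => [x _|i]; first by apply: continuousM; [exact: cf|exact: cg].
have [df1 df2] := df i; have [dg1 dg2] := dg i.
split => [x _|]; first by apply: derivableM; [exact: df1|exact: dg1].
rewrite (_ : partial i _ =
    fun x => f x * partial i g x + g x * partial i f x); last first.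
  by apply/funext => x; rewrite /partial deriveM//; [exact: df1|exact: dg1].
by apply: CrD; apply: IH => //; exact: CrW.
Qed.

Lemma Cr_sum r (I : finType) (f : I -> 'rV[R]_n -> R) :
  (forall i, Cr r setT (f i)) -> Cr r setT (fun x => \sum_i f i x).
Proof.
move=> Hf; rewrite (_ : (fun _ => _) = \sum_i f i); last first.
  by apply/funext => x; rewrite fct_sumE.
by elim/big_ind : _ => // [|f1 f2]; [exact: Cr_cst|exact: CrD].
Qed.

Lemma Cr_coord r (j : 'I_n) : Cr r setT (fun x : 'rV[R]_n => x ord0 j).
Proof.
case: r => [|r]; first by split => // x _; exact: coord_continuous.
split => [x _|i]; first exact: coord_continuous.
split => [x _|]; first by have [] := is_derive_coord j x (delta_mx ord0 i).
rewrite (_ : partial i _ = fun=> (delta_mx ord0 i : 'rV[R]_n) ord0 j).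
  exact: Cr_cst.
apply/funext => x; rewrite /partial.
by have [_ ->] := is_derive_coord j x (delta_mx ord0 i).
Qed.

End Cr_polynomial.

Lemma Cr1_open (R : realType) n (U : set 'rV[R]_n) (f : 'rV[R]_n -> R)
    (df : 'rV[R]_n -> 'I_n -> R) :
  open U ->
  (forall x, U x -> {for x, continuous f}) ->
  (forall x i, U x -> is_derive x (delta_mx ord0 i : 'rV_n) f (df x i)) ->
  (forall x i, U x -> {for x, continuous (df ^~ i)}) ->
  Cr 1 U f.
Proof.
move=> oU cf hf cdf; split => // i; split => [x Ux|].
  by have [] := hf x i Ux.
split => // x Ux; have pE y : U y -> partial i f y = df y i.
  by move=> Uy; have [_ <-] := hf y i Uy.
(* The partial derivative is known on [U] only; as [U] is open, this is a whole neighbourhood of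
   [x]. *)
rewrite /prop_for /continuous_at pE//; have E : {near x, df ^~ i =1 partial i f}.
  have : nbhs x U by exact: open_nbhs_nbhs.
  by apply: filterS => y /pE ->.
exact: (cvg_trans (near_eq_cvg E) (cdf x i Ux)).
Qed.

Section radial_calculus.
Context {R : realType} {m p : nat}.
Variable c : 'rV[R]_(m + p).
Implicit Types (x v : 'rV[R]_(m + p)).

Definition ycoord x : 'rV[R]_m := lsubmx (x - c).
Definition zcoord x : 'rV[R]_p := rsubmx (x - c).
Definition ysq x : R := dotr (ycoord x) (ycoord x).
Definition zsq x : R := dotr (zcoord x) (zcoord x).

Lemma ycoordE x b : ycoord x ord0 b = x ord0 (lshift p b) - c ord0 (lshift p b).
Proof. by rewrite /ycoord !mxE. Qed.

Lemma zcoordE x l : zcoord x ord0 l = x ord0 (rshift m l) - c ord0 (rshift m l).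
Proof. by rewrite /zcoord !mxE. Qed.

Lemma is_derive_ycoord x v b :
  is_derive x v (fun x => ycoord x ord0 b) (v ord0 (lshift p b)).
Proof.
under eq_fun do rewrite ycoordE.
rewrite -[X in is_derive _ _ _ X]subr0; apply: is_deriveB.
exact: is_derive_coord.
Qed.

Lemma is_derive_zcoord x v l :
  is_derive x v (fun x => zcoord x ord0 l) (v ord0 (rshift m l)).
Proof.
under eq_fun do rewrite zcoordE.
rewrite -[X in is_derive _ _ _ X]subr0; apply: is_deriveB.
exact: is_derive_coord.
Qed.

Lemma is_derive_sumE (V : normedModType R) (I : finType) (f : I -> V -> R)
    (df : I -> R) (x v : V) :
  (forall i, is_derive x v (f i) (df i)) ->
  is_derive x v (fun y => \sum_i f i y) (\sum_i df i).
Proof.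
move=> hf; rewrite (_ : (fun _ => _) = \sum_i f i); last first.
  by apply/funext => y; rewrite fct_sumE.
by elim/big_ind2 : _ => // [|f1 d1 f2 d2 h1 h2];
  [exact: is_derive_cst|exact: is_deriveD].
Qed.

Lemma is_derive_ysq x v :
  is_derive x v ysq (2 * dotr (ycoord x) (lsubmx v)).
Proof.
rewrite /ysq /dotr mulr_sumr; apply: is_derive_sumE => b.
have h := is_derive_ycoord x v b.
have := is_deriveM h h; rewrite (_ : _ + _ = 2 * (ycoord x ord0 b * lsubmx v ord0 b))//.
by rewrite !mxE -mulr2n mulr_natl.
Qed.

Lemma is_derive_zsq x v :
  is_derive x v zsq (2 * dotr (zcoord x) (rsubmx v)).
Proof.
rewrite /zsq /dotr mulr_sumr; apply: is_derive_sumE => b.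
have h := is_derive_zcoord x v b.
have := is_deriveM h h; rewrite (_ : _ + _ = 2 * (zcoord x ord0 b * rsubmx v ord0 b))//.
by rewrite !mxE -mulr2n mulr_natl.
Qed.

Lemma Cr_ycoord r b : Cr r setT (fun x => ycoord x ord0 b).
Proof.
under eq_fun do rewrite ycoordE.
by apply: CrD; [exact: Cr_coord|exact: Cr_cst].
Qed.

Lemma Cr_zcoord r b : Cr r setT (fun x => zcoord x ord0 b).
Proof.
under eq_fun do rewrite zcoordE.
by apply: CrD; [exact: Cr_coord|exact: Cr_cst].
Qed.

Lemma Cr_ysq r : Cr r setT ysq.
Proof. by apply: Cr_sum => b; apply: CrM; exact: Cr_ycoord. Qed.

Lemma Cr_zsq r : Cr r setT zsq.
Proof. by apply: Cr_sum => b; apply: CrM; exact: Cr_zcoord. Qed.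

Lemma continuous_ysq : continuous ysq.
Proof. by have [+ _] := Cr_ysq 0; move=> + x; exact. Qed.

End radial_calculus.

(** * Components of the radial fields and their gradients *)

Section radial_functions.
Context {R : realType} {m p : nat}.
Variable c : 'rV[R]_(m + p).
Implicit Types (x v : 'rV[R]_(m + p)) (a : 'rV[R]_m).

(** Half of [- m], because the base is [ysq], the square of [|y|]. *)
Definition radial_exponent : R := - (m%:R / 2).

Local Notation ysq := (ysq c).
Local Notation ycoord := (ycoord c).

(* [|y|^(-m) <y, a>], which is homogeneous of degree [1 - m] in [y]. *)
Definition radial a x : R := ysq x `^ radial_exponent * dotr (ycoord x) a.

Definition dradial a x (j : 'I_(m + p)) : R :=
  ysq x `^ radial_exponent * (dotr (lsubmx (delta_mx ord0 j)) a -
    m%:R * pad p (ycoord x) ord0 j / ysq x * dotr (ycoord x) a).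

Lemma lsubmx_delta (b : 'I_m) (j : 'I_(m + p)) :
  (lsubmx (delta_mx ord0 j) : 'rV[R]_m) ord0 b = pad p (delta_mx ord0 b) ord0 j.
Proof.
case: (split_ordP j) => i ->; rewrite ?padl ?padr !mxE ?(inj_eq (@lshift_inj _ _)).
  by rewrite eq_sym.
by rewrite eq_lrshift andbF.
Qed.

Lemma dotr_lsubmx_delta (y : 'rV[R]_m) (j : 'I_(m + p)) :
  dotr y (lsubmx (delta_mx ord0 j)) = pad p y ord0 j.
Proof.
case: (split_ordP j) => i ->; rewrite /dotr ?padl ?padr.
  rewrite (bigD1 i)//= big1 ?addr0 => [|b bi]; rewrite !mxE.
    by rewrite !eqxx mulr1.
  by rewrite (inj_eq (@lshift_inj _ _)) (negbTE bi) andbF mulr0.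
by rewrite big1// => b _; rewrite !mxE eq_lrshift andbF mulr0.
Qed.

Lemma dotr_delta_pad (y a : 'rV[R]_m) :
  \sum_j pad p y ord0 j * dotr (lsubmx (delta_mx ord0 j)) a = dotr y a.
Proof.
rewrite big_split_ord/= [X in _ + X]big1 ?addr0 => [|l _]; last first.
  by rewrite padr mul0r.
apply: eq_bigr => b _; rewrite padl; congr (_ * _).
rewrite /dotr (bigD1 b)//= big1 ?addr0 => [|d db]; rewrite !mxE.
  by rewrite !eqxx mul1r.
by rewrite (inj_eq (@lshift_inj _ _)) (negbTE db) andbF mul0r.
Qed.

Lemma pad_sq (y : 'rV[R]_m) :
  \sum_j pad p y ord0 j * pad p y ord0 j = dotr y y.
Proof.
rewrite big_split_ord/= [X in _ + X]big1 ?addr0 => [|l _]; last first.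
  by rewrite padr mul0r.
by apply: eq_bigr => b _; rewrite padl.
Qed.

Lemma is_derive_radial a x j : 0 < ysq x ->
  is_derive x (delta_mx ord0 j : 'rV_(m + p)) (radial a) (dradial a x j).
Proof.
move=> s0; set v := delta_mx ord0 j : 'rV_(m + p).
have hy := is_derive_ysq c x v.
have hp := is_derive_comp1 hy (is_derive1_powR radial_exponent s0).
have Ep : ysq x `^ (radial_exponent - 1) = ysq x `^ radial_exponent / ysq x.
  by rewrite powRB ?(powRr1 (ltW s0))// (gt_eqF s0) implybT.
rewrite {}Ep in hp.
have ha : is_derive x v (fun x => dotr (ycoord x) a) (dotr (lsubmx v) a).
  apply: is_derive_sumE => b.
  have := is_deriveM (is_derive_ycoord c x v b) (is_derive_cst (a ord0 b) x v).
  rewrite (_ : _ + _ = (lsubmx v : 'rV_m) ord0 b * a ord0 b)//.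
  by rewrite scaler0 add0r [in RHS]mxE mulrC.
suff <- : ysq x `^ radial_exponent * dotr (lsubmx v) a + dotr (ycoord x) a *
    (radial_exponent * (ysq x `^ radial_exponent / ysq x) *
      (2 * dotr (ycoord x) (lsubmx v))) = dradial a x j by exact: is_deriveM hp ha.
rewrite /dradial dotr_lsubmx_delta /radial_exponent -/v.
by field; rewrite gt_eqF.
Qed.

Lemma ysq_open : open [set x | 0 < ysq x].
Proof.
apply: (@open_comp _ _ ysq [set s | 0 < s]); last exact: open_gt.
by move=> x _; exact: continuous_ysq.
Qed.

Lemma continuous_powR_ysq (e : R) x : 0 < ysq x ->
  {for x, continuous (fun x => ysq x `^ e)}.
Proof.
move=> s0; have cp : {for ysq x, continuous (fun s : R => s `^ e)}.
  apply/differentiable_continuous/derivable1_diffP.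
  by have [] := is_derive1_powR e s0.
exact: (continuous_comp (@continuous_ysq _ _ _ c x) cp).
Qed.

Lemma continuous_dotr_ycoord a : continuous (fun x => dotr (ycoord x) a).
Proof.
move=> x; have H : Cr 0 setT (fun x => dotr (ycoord x) a).
  apply: Cr_sum => b; apply: CrM; [exact: Cr_ycoord|exact: Cr_cst].
by have [+ _] := H; exact.
Qed.

Lemma continuous_radial a x : 0 < ysq x -> {for x, continuous (radial a)}.
Proof.
move=> s0; apply: continuousM; first exact: continuous_powR_ysq.
exact: continuous_dotr_ycoord.
Qed.

Lemma continuous_dradial a x j : 0 < ysq x ->
  {for x, continuous (fun x => dradial a x j)}.
Proof.
move=> s0; apply: continuousM; first exact: continuous_powR_ysq.
apply: continuousB; first exact: cst_continuous.
apply: continuousM; last exact: continuous_dotr_ycoord.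
apply: continuousM; last first.
  by apply: continuousV; [rewrite gt_eqF|exact: continuous_ysq].
apply: continuousM; first exact: cst_continuous.
rewrite (_ : (fun x => _) =
    fun x => dotr (ycoord x) (lsubmx (delta_mx ord0 j))).
  exact: continuous_dotr_ycoord.
by apply/funext => y; rewrite dotr_lsubmx_delta.
Qed.

Lemma Cr1_radial a : Cr 1 [set x | 0 < ysq x] (radial a).
Proof.
apply: (@Cr1_open _ _ _ _ (dradial a)); first exact: ysq_open.
- by move=> x; exact: continuous_radial.
- by move=> x i; exact: is_derive_radial.
- by move=> x i; exact: continuous_dradial.
Qed.

Lemma radial_euler a x : 0 < ysq x ->
  \sum_j pad p (ycoord x) ord0 j * dradial a x j = (1 - m%:R) * radial a x.
Proof.
move=> s0; set h := ysq x `^ radial_exponent.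
transitivity (h * (\sum_j pad p (ycoord x) ord0 j *
    dotr (lsubmx (delta_mx ord0 j)) a) -
    h * m%:R / ysq x * dotr (ycoord x) a *
    \sum_j pad p (ycoord x) ord0 j * pad p (ycoord x) ord0 j).
  rewrite mulr_sumr [X in _ - X]mulr_sumr -sumrB; apply: eq_bigr => j _.
  by rewrite /dradial -/h; ring.
rewrite dotr_delta_pad pad_sq -/(ysq x) /radial -/h.
by field; rewrite gt_eqF.
Qed.

(* Expanding [sum_j (d_j u - b y_j)^2 >= 0] with [b = (1 - m) u / |y|^2]. *)
Lemma radial_grad_ge a x : (1 < m)%N -> 0 < ysq x ->
  radial a x ^+ 2 / ysq x <= \sum_j dradial a x j ^+ 2.
Proof.
move=> m1 s0; set u := radial a x; set b := (1 - m%:R) * u / ysq x.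
have : 0 <= \sum_j (dradial a x j - b * pad p (ycoord x) ord0 j) ^+ 2.
  by apply: sumr_ge0 => j _; exact: sqr_ge0.
rewrite (_ : \sum_j _ = \sum_j dradial a x j ^+ 2 -
    2 * b * (\sum_j pad p (ycoord x) ord0 j * dradial a x j) +
    b ^+ 2 * (\sum_j pad p (ycoord x) ord0 j * pad p (ycoord x) ord0 j)).
  rewrite radial_euler// pad_sq -/(ysq x) -/u /b.
  rewrite (_ : _ - _ + _ = \sum_j dradial a x j ^+ 2 -
     (m%:R - 1) ^+ 2 * (u ^+ 2 / ysq x)); last by field; rewrite gt_eqF.
  rewrite subr_ge0; apply: le_trans.
  rewrite ler_peMl ?divr_ge0 ?sqr_ge0 ?(ltW s0)//.
  (* The optimal factor is [(m - 1)^2], which is at least 1 only because [m >= 2], that is,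
     [k <= n - 1]. *)
  have : 2 <= m%:R :> R by rewrite (ler_nat _ 2 m).
  by nra.
rewrite [X in _ - X + _]mulr_sumr [X in _ + X]mulr_sumr -sumrB -big_split/=.
by apply: eq_bigr => j _; ring.
Qed.

End radial_functions.

(** * Closed and co-closed forms with radial coefficients *)

Lemma skew_combination (R : realType) m n k (h l : R) (G : 'I_m -> 'I_n -> k.-tuple _ -> R)
    (G' : 'I_n -> k.-tuple _ -> R) K :
  Defs.skew (fun j J => h * (\sum_b G b j J) - l * G' j J) K =
  h * (\sum_b Defs.skew (G b) K) - l * Defs.skew G' K.
Proof.
rewrite /Defs.skew exchange_big/= !mulr_sumr -sumrB; apply: eq_bigr => i _.
rewrite -mulr_sumr mulrBr; congr (_ - _); [exact: mulrCA|exact: mulrCA].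
Qed.

Lemma contract_combination (R : realType) m n k (h l : R) (G : 'I_m -> 'I_n -> k.-tuple _ -> R)
    (G' : 'I_n -> k.-tuple _ -> R) K :
  Defs.contract (fun j J => h * (\sum_b G b j J) - l * G' j J) K =
  h * (\sum_b Defs.contract (G b) K) - l * Defs.contract G' K.
Proof.
case: k G G' K => [|k'] G G' K /=.
  by rewrite big1// !mulr0 subr0.
by rewrite exchange_big/= !mulr_sumr -sumrB.
Qed.

Lemma wedgeZ (R : realType) n k (v : 'rV[R]_n) h (a : k.-tuple 'I_n -> R) K :
  wedge v (fun J => h * a J) K = h * wedge v a K.
Proof.
rewrite /wedge /Defs.skew mulr_sumr; apply: eq_bigr => l _.
by rewrite [RHS]mulrCA; congr (_ * _); exact: mulrCA.
Qed.

Lemma interior_productZ (R : realType) n k (v : 'rV[R]_n) h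
    (a : k.-tuple 'I_n -> R) K :
  interior_product v (fun J => h * a J) K = h * interior_product v a K.
Proof.
rewrite /interior_product; case: k a K => [|k] a K /=; first by rewrite mulr0.
by rewrite mulr_sumr; apply: eq_bigr => j _; exact: mulrCA.
Qed.

Section radial_forms.
Context {R : realType} {m p k : nat}.
Variables (c : 'rV[R]_(m + p)).
Variable A : 'rV[R]_m -> k.-tuple 'I_(m + p) -> R.
Hypothesis Alin : linear_covector A.
Local Notation ysq := (ysq c).
Local Notation ycoord := (ycoord c).

Definition coefs (J : k.-tuple 'I_(m + p)) : 'rV[R]_m :=
  \row_b A (delta_mx ord0 b) J.

Definition rform x (J : k.-tuple 'I_(m + p)) : R := radial c (coefs J) x.

Definition drform x j (J : k.-tuple 'I_(m + p)) : R :=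
  dradial c (coefs J) x j.

Lemma dotr_coefs y J : dotr y (coefs J) = A y J.
Proof. by rewrite Alin; apply: eq_bigr => b _; rewrite mxE. Qed.

Lemma rformE x J :
  rform x J = ysq x `^ (radial_exponent (m := m)) * A (ycoord x) J.
Proof. by rewrite /rform /radial dotr_coefs. Qed.

Lemma rform_fun x : rform x = fun J =>
  ysq x `^ (radial_exponent (m := m)) * A (ycoord x) J.
Proof. by apply/funext => J; exact: rformE. Qed.

(** The gradient is a combination of tensors of [v] with [A v], for [v = e_b] and [v = y].
    Antisymmetrising or contracting them gives the wedge and interior products of [v] with [A v]. *)
Lemma drformE x : drform x = fun j J =>
  ysq x `^ (radial_exponent (m := m)) *
    \sum_b pad p (delta_mx ord0 b) ord0 j * A (delta_mx ord0 b) J -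
  ysq x `^ (radial_exponent (m := m)) * m%:R / ysq x *
    (pad p (ycoord x) ord0 j * A (ycoord x) J).
Proof.
apply/funext => j; apply/funext => J.
rewrite /drform /dradial !dotr_coefs Alin.
under eq_bigr do rewrite lsubmx_delta.
by ring.
Qed.

Lemma dotr_delta (b : 'I_m) : dotr (delta_mx ord0 b) (delta_mx ord0 b) = 1 :> R.
Proof.
rewrite /dotr (bigD1 b)//= big1 ?addr0 => [|d db]; rewrite !mxE.
  by rewrite !eqxx mulr1.
by rewrite (negbTE db) andbF mulr0.
Qed.

(** The [m] vectors [e_b] contribute [m * C] and the vector [y] contributes
    [- (m / |y|^2) * C * |y|^2]: this cancellation dictates the exponent [- m]. The same holds for
    [codiff]. *)
Lemma ext_d_drform x :
  (forall K, exists C, forall y,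
    wedge (pad p y) (A y) K = C * dotr y y) ->
  0 < ysq x -> forall K, ext_d drform x K = 0.
Proof.
move=> hA s0 K; have [C hC] := hA K.
rewrite /ext_d drformE skew_combination.
under eq_bigr do rewrite -/(wedge _ _ K) hC dotr_delta mulr1.
rewrite -/(wedge _ _ K) hC -/(ysq x) sumr_const card_ord -mulr_natl.
by field; rewrite gt_eqF.
Qed.

Lemma codiff_drform x :
  (forall K, exists C, forall y,
    interior_product (pad p y) (A y) K = C * dotr y y) ->
  0 < ysq x -> forall K, codiff drform x K = 0.
Proof.
move=> hA s0 K; have [C hC] := hA K.
rewrite /codiff drformE contract_combination.
under eq_bigr do rewrite -/(interior_product _ _ K) hC dotr_delta mulr1.
rewrite -/(interior_product _ _ K) hC -/(ysq x) sumr_const card_ord -mulr_natl.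
by field; rewrite gt_eqF.
Qed.

Lemma sqnorm_drform_ge x : (1 < m)%N -> 0 < ysq x ->
  sqnorm (rform x) / ysq x <= \sum_j sqnorm (drform x j).
Proof.
move=> m1 s0; rewrite /sqnorm exchange_big/= mulr_suml; apply: ler_sum => J _.
exact: radial_grad_ge.
Qed.

End radial_forms.

(** * The domain *)

Section null_integral.
Local Open Scope ereal_scope.

Import HBNNSimple.

(* For [mu = hausdorff_measure s], which is not declared as a measure. *)
Lemma integral0_set_function d (T : measurableType d) (R : realType)
    (mu : set T -> \bar R) (D : set T) (f : T -> \bar R) :
  mu set0 = 0 -> (forall x, D x -> f x = 0) -> \int[mu]_(x in D) f x = 0.
Proof.
move=> mu0 f0.
(* The only non-negative simple function below 0 is 0: its level 0 has weight 0 and its other level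
   sets are empty. *)
have nn0 : ereal_sup [set sintegral mu h |
    h in [set h : {nnsfun T >-> R} | forall x, (h x)%:E <= 0]] = 0.
  have s0 (h : {nnsfun T >-> R}) : (forall x, (h x)%:E <= 0) ->
      sintegral mu h = 0.
    move=> h0; have hE x : h x = 0%R.
      by apply/eqP; rewrite eq_le -lee_fin h0 fun_ge0.
    rewrite /sintegral fsbig1// => r _.
    have [->|r0] := eqVneq r 0%R; first by rewrite mul0e.
    rewrite (_ : _ @^-1` _ = set0) ?mu0 ?mule0//.
    by apply/seteqP; split => // x /=; rewrite hE => /esym/eqP; rewrite (negbTE r0).
  rewrite (_ : [set _ | _ in _] = [set 0]) ?ereal_sup1//.
  apply/seteqP; split => [_ [h h0 <-]|_ ->]; first exact: s0.
  by exists nnsfun0 => //; exact: s0.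
have f0D : f \_ D = cst 0.
  by apply/funext => x; rewrite patchE; case: ifPn => // /[1!inE] /f0.
have pos0 : (cst 0 : T -> \bar R)^\+ = cst 0.
  by apply/funext => x; rewrite funeposE maxxx.
have neg0 : (cst 0 : T -> \bar R)^\- = cst 0.
  by apply/funext => x; rewrite funenegE oppe0 maxxx.
by rewrite /integral f0D pos0 neg0 nn0 sube0.
Qed.

End null_integral.

Lemma ediam_ge0 (R : realType) n (A : set 'rV[R]_n) : (0 <= ediam A)%E.
Proof. by apply: ereal_sup_ubound; left. Qed.

(** The only value of the surface measure that is needed: the traces are attained exactly and the
    boundary condition has no exceptional point. *)
Lemma hausdorff_measure0 (R : realType) n (s : nat) : (0 < s)%N ->
  hausdorff_measure s (set0 : set 'rV[R]_n) = 0%E.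
Proof.
move=> s0; rewrite /hausdorff_measure (_ : [set _ | _ in _] = [set 0%E]).
  by rewrite ereal_sup1.
have ediam0 : ediam (set0 : set 'rV[R]_n) = 0%E.
  rewrite /ediam (_ : [set _ | _] = [set 0%E]) ?ereal_sup1//.
  by apply/seteqP; split => [d [->//|[x [y []]]]|d ->]//; exact: or_introl.
have c0 e : 0 < e -> hausdorff_content s e (set0 : set 'rV[R]_n) = 0%E.
  move=> e0; apply/eqP; rewrite eq_le; apply/andP; split.
    apply: ereal_inf_lbound; exists (fun=> set0).
      by split => [|i]; [exact: sub0set|rewrite ediam0 lee_fin ltW].
    apply: eseries0 => i _ _; rewrite ediam0.
    by case: s s0 => // s _; rewrite expeS mul0e.
  apply: le_ereal_inf_tmp => _ [C _ <-]; apply: nneseries_ge0 => i _ _.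
  by rewrite expe_ge0// ediam_ge0.
apply/seteqP; split => [_ [e e0 <-]|_ ->]; first exact: c0.
by exists 1; [exact: ltr01|exact: c0].
Qed.

(** * Geometry of the thickened sphere-times-ball *)

Section domain.
Context {R : realType} {m p : nat}.
Variables (c : 'rV[R]_(m + p)) (t : R).
Hypothesis t0 : 0 < t.
Local Notation ysq := (ysq c).
Local Notation ycoord := (ycoord c).
Local Notation zsq := (zsq c).
Local Notation zcoord := (zcoord c).

Definition ring_fun (x : 'rV[R]_(m + p)) : R :=
  (ysq x - 2 * t) ^+ 2 + t * zsq x - t ^+ 2.

Definition ring_domain : set 'rV[R]_(m + p) := [set x | ring_fun x < 0].

Lemma dotr_ge0 k (y : 'rV[R]_k) : 0 <= dotr y y.
Proof. by apply: sumr_ge0 => i _; rewrite -expr2 sqr_ge0. Qed.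

Lemma ring_fun_le0 x : ring_fun x <= 0 -> t <= ysq x <= 3 * t /\ zsq x <= t.
Proof.
rewrite /ring_fun => Fx; have := dotr_ge0 (zcoord x); rewrite -/(zsq x) => z0.
have := dotr_ge0 (ycoord x); rewrite -/(ysq x) => y0.
have d2 := sqr_ge0 (ysq x - 2 * t).
have tz : 0 <= t * zsq x by rewrite mulr_ge0// ltW.
split; last first.
  rewrite leNgt; apply/negP => zt.
  have : t * t < t * zsq x by rewrite ltr_pM2l.
  by nra.
(* With [s = ysq x], [(s - t) * (s - 3 * t) = (s - 2 * t)^2 - t^2], which is positive for [s]
   outside [[t, 3 t]]. *)
apply/andP; split; rewrite leNgt; apply/negP => h.
  have : 0 < (t - ysq x) * (3 * t - ysq x) by apply: mulr_gt0; lra.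
  by nra.
have : 0 < (ysq x - t) * (ysq x - 3 * t) by apply: mulr_gt0; lra.
by nra.
Qed.

Lemma ring_fun_ysq x : ring_fun x <= 0 -> 0 < ysq x.
Proof. by move=> /ring_fun_le0[/andP[+ _] _]; exact: lt_le_trans. Qed.

Lemma smooth_ring_fun : smooth setT ring_fun.
Proof.
move=> r; rewrite (_ : ring_fun = fun x => (ysq x - 2 * t) * (ysq x - 2 * t) +
   t * zsq x - t ^+ 2); last by apply/funext => x; rewrite /ring_fun expr2.
apply: CrD; last exact: Cr_cst.
apply: CrD; apply: CrM; try exact: Cr_cst; try exact: Cr_zsq.
all: by apply: CrD; [exact: Cr_ysq|exact: Cr_cst].
Qed.

Lemma continuous_ring_fun : continuous ring_fun.
Proof. by have [+ _] := smooth_ring_fun 0; move=> + x; exact. Qed.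

Lemma dotr_delta_row k (y : 'rV[R]_k) (i : 'I_k) :
  dotr y (delta_mx ord0 i) = y ord0 i.
Proof.
rewrite /dotr (bigD1 i)//= big1 ?addr0 => [|b bi]; rewrite !mxE.
  by rewrite !eqxx mulr1.
by rewrite (negbTE bi) andbF mulr0.
Qed.

Lemma delta_mx_lshift (i : 'I_m) :
  delta_mx ord0 (lshift p i) = row_mx (delta_mx ord0 i) 0 :> 'rV[R]_(m + p).
Proof.
apply/rowP => j; case: (split_ordP j) => b ->.
  by rewrite row_mxEl !mxE (inj_eq (@lshift_inj _ _)).
by rewrite row_mxEr !mxE eq_rlshift andbF.
Qed.

Lemma delta_mx_rshift (i : 'I_p) :
  delta_mx ord0 (rshift m i) = row_mx 0 (delta_mx ord0 i) :> 'rV[R]_(m + p).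
Proof.
apply/rowP => j; case: (split_ordP j) => b ->.
  by rewrite row_mxEl !mxE eq_lrshift andbF.
by rewrite row_mxEr !mxE (inj_eq (@rshift_inj _ _)).
Qed.

Lemma dotr0 k (y : 'rV[R]_k) : dotr y 0 = 0.
Proof. by rewrite /dotr big1// => i _; rewrite mxE mulr0. Qed.

Lemma is_derive_ring_fun x v : is_derive x v ring_fun
  (4 * (ysq x - 2 * t) * dotr (ycoord x) (lsubmx v) +
   2 * t * dotr (zcoord x) (rsubmx v)).
Proof.
have hy := is_derive_ysq c x v; have hz := is_derive_zsq c x v.
have h1 := is_deriveB hy (is_derive_cst (2 * t) x v).
have h2 := is_deriveM h1 h1.
have h3 := is_deriveM (is_derive_cst t x v) hz.
have h4 := is_deriveB (is_deriveD h2 h3) (is_derive_cst (t ^+ 2) x v).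
rewrite (_ : ring_fun = (ysq - cst (2 * t)) * (ysq - cst (2 * t)) +
  cst t * zsq - cst (t ^+ 2)); last first.
  by apply/funext => y; rewrite /ring_fun expr2.
set D := 4 * _ * _ + _.
suff -> : D = ((ysq x - 2 * t) * (2 * dotr (ycoord x) (lsubmx v) - 0) +
     (ysq x - 2 * t) * (2 * dotr (ycoord x) (lsubmx v) - 0)) +
   (t * (2 * dotr (zcoord x) (rsubmx v)) + zsq x * 0) - 0 by exact: h4.
by rewrite /D; ring.
Qed.

Lemma grad_ring_fun x : grad ring_fun x =
  row_mx ((4 * (ysq x - 2 * t)) *: ycoord x) ((2 * t) *: zcoord x).
Proof.
apply/rowP => j; rewrite mxE /partial.
have [_ ->] := is_derive_ring_fun x (delta_mx ord0 j).
case: (split_ordP j) => i ->.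
  rewrite delta_mx_lshift row_mxKl row_mxKr row_mxEl dotr_delta_row dotr0.
  by rewrite mulr0 addr0 [RHS]mxE.
rewrite delta_mx_rshift row_mxKl row_mxKr row_mxEr dotr_delta_row dotr0.
by rewrite mulr0 add0r [RHS]mxE.
Qed.

Lemma ring_domain_open : open ring_domain.
Proof.
apply: (@open_comp _ _ ring_fun [set s | s < 0]); last exact: open_lt.
by move=> x _; exact: continuous_ring_fun.
Qed.

Lemma ring_closed : closed [set x | ring_fun x <= 0].
Proof.
have /continuous_closedP/(_ [set s | s <= 0]) := continuous_ring_fun.
by apply; exact: closed_le.
Qed.

Lemma closure_ring_domain : closure ring_domain `<=` [set x | ring_fun x <= 0].
Proof.
have /closure_id -> := ring_closed.
by apply: closureS => x; exact: ltW.
Qed.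

Lemma boundary_ring_domain x : boundary ring_domain x -> ring_fun x = 0.
Proof.
move=> [/closure_ring_domain /= Fx].
have /interior_id -> := ring_domain_open.
by move=> /negP; rewrite -leNgt => ?; apply/eqP; rewrite eq_le Fx.
Qed.

Lemma dotrZ k a (y w : 'rV[R]_k) : dotr (a *: y) w = a * dotr y w.
Proof.
by rewrite /dotr mulr_sumr; apply: eq_bigr => i _; rewrite mxE mulrA.
Qed.

Lemma dot0r k (y : 'rV[R]_k) : dotr 0 y = 0.
Proof. by rewrite /dotr big1// => i _; rewrite mxE mul0r. Qed.

(** A critical point with [y] non-zero has [|y|^2 = 2 t] and [z = 0]; there [ring_fun] equals
    [- t^2], so it is not on the zero set. *)
Lemma ring_local_defining x : ring_fun x = 0 ->
  local_defining_function ring_domain x setT ring_fun.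
Proof.
move=> Fx; split => //; [exact: openT|exact: smooth_ring_fun|].
rewrite grad_ring_fun; apply/eqP => G0.
have s0 : 0 < ysq x by apply: ring_fun_ysq; rewrite Fx.
have Gy : (4 * (ysq x - 2 * t)) *: ycoord x = 0.
  by move/(congr1 lsubmx) : G0; rewrite row_mxKl linear0.
have Gz : (2 * t) *: zcoord x = 0.
  by move/(congr1 rsubmx) : G0; rewrite row_mxKr linear0.
move/(congr1 (dotr ^~ (ycoord x))) : Gy; rewrite dotrZ dot0r -/(ysq x) => /eqP.
rewrite !mulf_eq0 pnatr_eq0/= (gt_eqF s0) orbF subr_eq0 => /eqP s2t.
move/(congr1 (dotr ^~ (zcoord x))) : Gz; rewrite dotrZ dot0r -/(zsq x) => /eqP.
rewrite !mulf_eq0 pnatr_eq0/= (gt_eqF t0)/= => /eqP z0.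
move: Fx; rewrite /ring_fun s2t z0 subrr expr0n/= mulr0 addr0 sub0r => /eqP.
by rewrite oppr_eq0 expf_eq0/= (gt_eqF t0).
Qed.

Lemma sum_sub_sq x :
  \sum_i (x - c) ord0 i ^+ 2 = ysq x + zsq x.
Proof.
rewrite big_split_ord/=; congr (_ + _); apply: eq_bigr => i _.
  by rewrite ycoordE -expr2 !mxE.
by rewrite zcoordE -expr2 !mxE.
Qed.

Lemma ring_bounded : bounded_set [set x | ring_fun x <= 0].
Proof.
exists (`|c| + (1 + 4 * t)); split; first exact: num_real.
move=> M ltM x /= /ring_fun_le0[/andP[_ ys] zs].
have e0 : 0 < 1 + 4 * t by rewrite addr_gt0// mulr_gt0.
(* Each coordinate of [x - c] has square at most [4 t], less than [(1 + 4 t)^2]; this radius avoids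
   a square root. *)
have : ball c (1 + 4 * t) x.
  apply/rV_ballP => // i.
  have : (x - c) ord0 i ^+ 2 <= 4 * t.
    have := sum_sub_sq x; rewrite (bigD1 i)//= => xi.
    have : 0 <= \sum_(j < m + p | j != i) (x - c) ord0 j ^+ 2.
      by apply: sumr_ge0 => j _; exact: sqr_ge0.
    by lra.
  rewrite !mxE distrC -real_normK ?num_real// => xi2.
  rewrite ltNge; apply/negP => xi.
  have : (1 + 4 * t) * (1 + 4 * t) <= `|x ord0 i - c ord0 i| ^+ 2.
    by rewrite expr2 ler_pM// ltW.
  by nra.
rewrite -ball_normE/= => xc.
have := ler_normD c (x - c); rewrite addrC subrK [`|x - c|]distrC => xle.
by apply: le_trans xle _; apply/ltW/(le_lt_trans _ ltM); rewrite lerD2l ltW.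
Qed.

Lemma ring_compact : compact [set x | ring_fun x <= 0].
Proof.
by apply: bounded_closed_compact; [exact: ring_bounded|exact: ring_closed].
Qed.

Lemma ring_domain_smooth : smooth_domain ring_domain.
Proof.
split; first exact: ring_domain_open.
  have [M [Mr hM]] := ring_bounded; exists M; split => // M' ltM x Fx.
  by apply: (hM M' ltM); exact: ltW.
move=> x /boundary_ring_domain Fx; exists setT, ring_fun.
exact: ring_local_defining.
Qed.

Lemma ring_domain_eball r : 0 < r -> 4 * t <= r ^+ 2 -> ring_domain `<=` eball c r.
Proof.
move=> r0 tr x Fx; rewrite /eball/= /enorm sum_sub_sq.
have [/andP[_ ys] zs] := ring_fun_le0 (ltW Fx).
rewrite -[ltRHS](ger0_norm (ltW r0)) -sqrtr_sqr ltr_sqrt ?exprn_gt0//.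
apply: lt_le_trans tr; rewrite ltNge; apply/negP => h.
(* Strictness: [|x - c|^2 = 4 t] would force both bounds to be attained, and [ring_fun] would then
   be [t^2 > 0]. *)
have s3t : ysq x = 3 * t by apply/eqP; rewrite eq_le ys/=; lra.
have zt : zsq x = t by apply/eqP; rewrite eq_le zs/=; lra.
move: Fx; rewrite /ring_domain/= /ring_fun s3t zt.
have : 0 < t * t by rewrite mulr_gt0.
by nra.
Qed.

(** The compact set [ring_fun <= 0] lies in [ysq > 0], so [f] is bounded on the domain, which has
    finite measure. *)
Lemma ring_domain_integrable (f : 'rV[R]_(m + p) -> R) :
  (forall x, 0 < ysq x -> {for x, continuous f}) ->
  measurable_fun ring_domain (f : _ -> measurableTypeR R) /\
  (lebesgue_rV R (m + p)).-integrable ring_domain (EFin \o f).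
Proof.
move=> cf; have mf : measurable_fun ring_domain (f : _ -> measurableTypeR R).
  apply: continuous_open_measurable; first exact: ring_domain_open.
  by move=> x Fx; apply/cf/ring_fun_ysq/ltW.
have mD : measurable ring_domain by apply: open_measurable_rV; exact: ring_domain_open.
split => //.
apply: (@measurable_bounded_integrable _ _ _ (lebesgue_rV R (m + p)) f) => //.
  by apply: lebesgue_rV_bounded_lty => //; have [] := ring_domain_smooth.
have : compact (f @` [set x | ring_fun x <= 0]).
  apply: continuous_compact; last exact: ring_compact.
  apply: continuous_in_subspaceT => x /[1!inE] /ring_fun_ysq; exact: cf.
move=> /compact_bounded; rewrite /bounded_near => -[M [Mr KM]].
by exists M; split => // N MN x Fx; apply: (KM N MN); exists x => //; exact: ltW.
Qed.

End domain.

(** * The forms on the domain *)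

Lemma continuous_at_sum (R : realType) (T : topologicalType) (I : finType)
    (P : pred I) (f : I -> T -> R) (x : T) :
  (forall i, {for x, continuous (f i)}) ->
  {for x, continuous (fun y => \sum_(i | P i) f i y)}.
Proof.
move=> cf; rewrite (_ : (fun _ => _) = \sum_(i | P i) f i); last first.
  by apply/funext => y; rewrite fct_sumE.
elim/big_ind : _ => // [|g h cg ch]; first exact: cst_continuous.
exact: (continuousD cg ch).
Qed.

Lemma continuous_sqr (R : realType) (T : topologicalType) (f : T -> R) (x : T) :
  {for x, continuous f} -> {for x, continuous (fun y => f y ^+ 2)}.
Proof. by move=> cf; exact: (continuousM cf cf). Qed.

Lemma dotrC (R : realType) n (x y : 'rV[R]_n) : dotr x y = dotr y x.
Proof. by apply: eq_bigr => i _; rewrite mulrC. Qed.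

Section ring_forms.
Context {R : realType} {m p k : nat}.
Variables (c : 'rV[R]_(m + p)) (t : R).
Hypothesis t0 : 0 < t.
Hypothesis m_gt1 : (1 < m)%N.
Variable A : 'rV[R]_m -> k.-tuple 'I_(m + p) -> R.
Hypothesis Alin : linear_covector A.
Local Notation ysq := (ysq c).
Local Notation ycoord := (ycoord c).
Local Notation D := (ring_domain c t).
Local Notation mu := (lebesgue_rV R (m + p)).
Local Notation w := (rform c A).
Local Notation Dw := (drform c A).

Let Dy x : D x -> 0 < ysq x.
Proof. by move=> Dx; apply: (ring_fun_ysq t0); exact: ltW. Qed.

Let bDy x : boundary D x -> 0 < ysq x.
Proof. by move=> /boundary_ring_domain Fx; apply: (ring_fun_ysq t0); rewrite Fx. Qed.

Lemma L2_ring_domain (f : 'rV[R]_(m + p) -> R) :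
  (forall x, 0 < ysq x -> {for x, continuous f}) -> L2 D f.
Proof.
move=> cf; split; first by have [] := ring_domain_integrable t0 cf.
have cf2 x : 0 < ysq x -> {for x, continuous (fun y => f y ^+ 2)}.
  by move=> /cf; exact: continuous_sqr.
have mD : measurable D by apply: open_measurable_rV; exact: ring_domain_open.
by have [_ ifD] := ring_domain_integrable t0 cf2; exact: (integrable_lty mD ifD).
Qed.

Lemma rform_W12 : (forall y, alternating_covector (A y)) -> W12 D w Dw.
Proof.
move=> Aalt; split => [x _ s J|J]; first by rewrite !rformE// Aalt mulrCA.
split; first by apply: L2_ring_domain => x; exact: continuous_radial.
move=> j; split; first by apply: L2_ring_domain => x; exact: continuous_dradial.
apply: (@classical_weak_partial _ _ _ [set x | 0 < ysq x]).
- exact: ysq_open.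
- exact: Dy.
- by move=> x; exact: continuous_radial.
- by move=> x; exact: continuous_dradial.
- by move=> x; exact: is_derive_radial.
Qed.

(** The form is C^1 on the neighbourhood [ysq > 0] of the closure, so the constant sequence
    approximates it and all the differences are zero. *)
Lemma rform_trace J : is_trace D (fun x => w x J) (fun x j => Dw x j J)
  (fun x => w x J).
Proof.
have cw x : 0 < ysq x -> {for x, continuous (fun x => w x J)}.
  exact: continuous_radial.
split.
  apply: (@measurable_funS _ _ _ _ [set x | 0 < ysq x]).
  - by apply: open_measurable_rV; exact: ysq_open.
  - exact: bDy.
  - by apply: continuous_open_measurable => //; exact: ysq_open.
exists (fun=> fun x => w x J); split.
- move=> _; exists [set x | 0 < ysq x]; split; first exact: ysq_open.
    by move=> x /closure_ring_domain; exact: ring_fun_ysq.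
  exact: Cr1_radial.
- rewrite (_ : (fun _ => _) = fun=> 0%E); first exact: cvg_cst.
  apply/funext => _; apply: integral0_set_function => // x _.
  by rewrite subrr expr0n.
- move=> j; rewrite (_ : (fun _ => _) = fun=> 0%E); first exact: cvg_cst.
  apply/funext => _; apply: integral0_set_function => // x /Dy s0.
  have [_] := is_derive_radial (coefs A J) j s0.
  by rewrite /partial -/(w _ J) => ->; rewrite subrr expr0n.
- rewrite (_ : (fun _ => _) = fun=> 0%E); first exact: cvg_cst.
  apply/funext => _; apply: integral0_set_function => [|x _].
    (* The dimension [(m + p).-1] of the boundary is positive because [m > 1]. *)
    by apply: hausdorff_measure0; case: m m_gt1 => [|[]].
  by rewrite subrr expr0n.
Qed.

Lemma rform_boundary_condition (P : 'rV[R]_(m + p) -> (k.-tuple 'I_(m + p) -> R) -> Prop) :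
  (forall x a z, P (row_mx (a *: ycoord x) z) (w x)) ->
  boundary_condition D w Dw P.
Proof.
move=> hP; exists w; split; first exact: rform_trace.
rewrite (_ : [set _ | _] = set0).
  by apply: hausdorff_measure0; case: m m_gt1 => [|[]].
apply/seteqP; split => // x [/boundary_ring_domain Fx]; apply.
exists ((enorm (grad (ring_fun c t) x))^-1 *: grad (ring_fun c t) x).
  by exists setT, (ring_fun c t); split => //; exact: ring_local_defining.
by rewrite grad_ring_fun scale_row_mx scalerA; exact: hP.
Qed.

Lemma sqnorm_ge0 (a : k.-tuple 'I_(m + p) -> R) : 0 <= sqnorm a.
Proof. by apply: sumr_ge0 => J _; exact: sqr_ge0. Qed.

Let cts_w x : 0 < ysq x -> {for x, continuous (fun x => sqnorm (w x))}.
Proof.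
move=> s0; apply: continuous_at_sum => J; apply: continuous_sqr.
exact: continuous_radial.
Qed.

Let cts_Dw x : 0 < ysq x ->
  {for x, continuous (fun x => \sum_j sqnorm (Dw x j))}.
Proof.
move=> s0; apply: continuous_at_sum => j; apply: continuous_at_sum => J.
by apply: continuous_sqr; exact: continuous_dradial.
Qed.

Lemma rform_sqnorm_gt0 : (exists J b, increasing J /\ forall y, A y J = y ord0 b) ->
  (0 < sqnorm_L2 D w)%E.
Proof.
move=> [J [b [incJ AJ]]].
(* A point of the core sphere [|y|^2 = 2 t], [z = 0], in the direction where the component [J] does
   not vanish. *)
pose x0 := c + row_mx (Num.sqrt (2 * t) *: delta_mx ord0 b) 0 : 'rV_(m + p).
have y0E : ycoord x0 = Num.sqrt (2 * t) *: delta_mx ord0 b.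
  by rewrite /ycoord /x0 [c + _]addrC addrK row_mxKl.
have s0E : ysq x0 = 2 * t.
  rewrite /ysq y0E dotrZ dotrC dotr_delta_row !mxE !eqxx mulr1 -expr2 sqr_sqrtr//.
  by rewrite mulr_ge0// ltW.
have s0 : 0 < ysq x0 by rewrite s0E mulr_gt0.
have Dx0 : D x0.
  rewrite /ring_domain/= /ring_fun s0E subrr /zsq /zcoord /x0.
  rewrite [c + _]addrC addrK row_mxKr dotr0 expr0n/= mulr0 add0r sub0r.
  by rewrite oppr_lt0 exprn_gt0.
pose e := sqnorm (w x0) / 2.
have w0 : 0 < sqnorm (w x0).
  rewrite /sqnorm (bigD1 J)//= ltr_pwDl//; last first.
    by apply: sumr_ge0 => K _; exact: sqr_ge0.
  rewrite exprn_even_gt0//= rformE// AJ y0E !mxE !eqxx mulr1.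
  by rewrite mulf_neq0// gt_eqF ?powR_gt0 ?sqrtr_gt0 ?mulr_gt0.
have e0 : 0 < e by rewrite divr_gt0.
(* By continuity the squared norm exceeds half its value at [x0] on an open set, which has positive
   measure. *)
pose O := D `&` [set x | e < sqnorm (w x)].
have oO : open O.
  rewrite openE => x [Dx ex]; apply: filterI.
    by apply: open_nbhs_nbhs; split => //; exact: ring_domain_open.
  have := cts_w (Dy Dx); move=> /(_ [set s | e < s]); apply.
  by apply: open_nbhs_nbhs; split => //; exact: open_gt.
have mO := open_measurable_rV oO.
have mD : measurable D by apply: open_measurable_rV; exact: ring_domain_open.
have [mw _] := ring_domain_integrable t0 cts_w.
apply: (@lt_le_trans _ _ (\int[mu]_(x in O) e%:E)%E).
  rewrite integral_cst//; apply: mule_gt0; first by rewrite lte_fin.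
  apply: lebesgue_rV_open_gt0 => //; exists x0; split => //=.
  by rewrite /e; lra.
apply: (@le_trans _ _ (\int[mu]_(x in O) (sqnorm (w x))%:E)%E).
  apply: ge0_le_integral => //.
  - by move=> x _; rewrite lee_fin ltW.
  - by apply/measurable_EFinP; apply: (measurable_funS mD _ mw); exact: subIsetl.
  - by move=> x [_ /= ex]; rewrite lee_fin ltW.
apply: ge0_subset_integral => //.
- exact/measurable_EFinP.
- by move=> x _; rewrite lee_fin sqnorm_ge0.
- by move=> x [].
Qed.

Lemma rform_gaffney_gt M :
  (forall K, exists C, forall y, wedge (pad p y) (A y) K = C * dotr y y) ->
  (forall K, exists C, forall y,
    interior_product (pad p y) (A y) K = C * dotr y y) ->
  (0 < sqnorm_L2 D w)%E -> M * (3 * t) < 1 -> M < gaffney_quotient D w Dw.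
Proof.
move=> hw hi wgt0 Mt.
have t3 : 0 < 3 * t by rewrite mulr_gt0.
have mD : measurable D by apply: open_measurable_rV; exact: ring_domain_open.
have [mw iw] := ring_domain_integrable t0 cts_w.
have [mDw iDw] := ring_domain_integrable t0 cts_Dw.
have d0 : sqnorm_L2 D (ext_d Dw) = 0%E.
  apply: integral0_eq => x /Dy s0; rewrite /sqnorm big1// => K _.
  by rewrite ext_d_drform// expr0n.
have c0 : sqnorm_L2 D (codiff Dw) = 0%E.
  apply: integral0_eq => x /Dy s0; rewrite /sqnorm big1// => K _.
  by rewrite codiff_drform// expr0n.
(* [fine] sends infinite values to 0, so finiteness comes before any estimate of the quotient. *)
have fw : sqnorm_L2 D w \is a fin_num by exact: (integrable_fin_num mD iw).
have fDw : sqnorm_grad D Dw \is a fin_num by exact: (integrable_fin_num mD iDw).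
have : ((3 * t)^-1%:E * sqnorm_L2 D w <= sqnorm_grad D Dw)%E.
  rewrite /sqnorm_L2 -integralZl//; apply: le_integral => //.
    exact: integrableZl.
  move=> x /[1!inE] Dx; rewrite -EFinM lee_fin.
  apply: (@le_trans _ _ (sqnorm (w x) / ysq x)); last first.
    by apply: sqnorm_drform_ge => //; exact: Dy.
  rewrite mulrC ler_wpM2l ?sqnorm_ge0// lef_pV2 ?posrE ?Dy//.
  by have [/andP[]] := ring_fun_le0 t0 (ltW Dx).
rewrite /gaffney_quotient d0 c0 !add0r -(fineK fw) -(fineK fDw) -EFinM lee_fin /=.
move: wgt0; rewrite -(fineK fw) lte_fin => a0 ab.
rewrite ltr_pdivlMr//; apply: lt_le_trans ab; rewrite ltr_pM2r//.
by rewrite -[ltRHS]mul1r ltr_pdivlMr.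
Qed.

(** The supremum unfolds to [C_T] or [C_N] according to [P]. The scalars [h] and [a] absorb the
    power of [|y|] and the normalisation of the normal. *)
Lemma rform_ereal_sup_gt M
    (P : 'rV[R]_(m + p) -> (k.-tuple 'I_(m + p) -> R) -> Prop) :
  (forall y, alternating_covector (A y)) ->
  (exists J b, increasing J /\ forall y, A y J = y ord0 b) ->
  (forall K, exists C, forall y, wedge (pad p y) (A y) K = C * dotr y y) ->
  (forall K, exists C, forall y,
    interior_product (pad p y) (A y) K = C * dotr y y) ->
  (forall y h a z, P (row_mx (a *: y) z) (fun J => h * A y J)) ->
  M * (3 * t) < 1 ->
  (M%:E < ereal_sup [set s | exists w' Dw',
    [/\ W12 D w' Dw' /\ boundary_condition D w' Dw' P,
        sqnorm_L2 D w' != 0%E & s = (gaffney_quotient D w' Dw')%:E]])%E.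
Proof.
move=> Aalt Aneq0 hw hi hP Mt; have wgt0 := rform_sqnorm_gt0 Aneq0.
apply: (@lt_le_trans _ _ (gaffney_quotient D w Dw)%:E).
  by rewrite lte_fin; exact: rform_gaffney_gt.
apply: ereal_sup_ubound; exists w, Dw; split; last by [].
  split; first exact: rform_W12.
  by apply: rform_boundary_condition => x a z; rewrite rform_fun//; exact: hP.
by rewrite gt_eqF.
Qed.

End ring_forms.

Theorem proposition17 (R : realType) (n k : nat)
    (hk1 : (1 <= k)%N) (hkn : (k <= n - 1)%N)
    (c : 'rV[R]_n) (r : R) (hr : 0 < r) (M : R) (hM : 0 < M) :
  exists Omega : set 'rV[R]_n,
    [/\ smooth_domain Omega, Omega `<=` eball c r,
        (M%:E < C_T Omega k)%E & (M%:E < C_N Omega (n - k)%N)%E].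
Proof.
case: k hk1 hkn => // p _ hkn.
(* Here [m = q.+2], at least 2 since [k <= n - 1]; the dual degree [n - k] is [m - 1 = q.+1]. *)
have [q nE] : exists q, n = (q.+2 + p)%N by exists (n - p).-2; lia.
subst n; have -> : (q.+2 + p - p.+1 = q.+1)%N by lia.
(* The first bound keeps the domain in the ball; the second makes [1 / (3 t)] at least [4 M / 3],
   hence larger than [M]. *)
pose t := Num.min (r ^+ 2 / 4) (1 / (4 * M)).
have t0 : 0 < t by rewrite lt_min !divr_gt0 ?mulr_gt0 ?exprn_gt0.
have tr : 4 * t <= r ^+ 2.
  by rewrite mulrC -ler_pdivlMr// /t ge_min lexx.
have tM : M * (3 * t) < 1.
  have : t * (4 * M) <= 1.
    by rewrite -ler_pdivlMr ?mulr_gt0// /t ge_min lexx orbT.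
  have := mulr_gt0 hM t0; lra.
exists (ring_domain c t); split.
- exact: ring_domain_smooth.
- exact: ring_domain_eball.
- apply: (@rform_ereal_sup_gt R q.+2 p p.+1 c t t0 isT (@tangential R q.+2 p)) => //.
  + exact: tangential_linear.
  + exact: tangential_alternating.
  + by have [J incJ AJ] := @tangential_neq0 R q.+1 p; exists J, ord0.
  (* [pad p y] is itself of the form [row_mx (a *: y) z], with [a = 1] and [z = 0], so the identity
     for the normal also gives this one. *)
  + by move=> K; exists 0 => y; rewrite mul0r -[in pad _ _](scale1r y)
      wedge_tangential_eq0.
  + by move=> K; exists (\det (tangential_mx K : 'M[R]_p)) => y;
      exact: interior_tangential.
  + by move=> y h a z J; rewrite wedgeZ wedge_tangential_eq0 mulr0.
- apply: (@rform_ereal_sup_gt R q.+2 p q.+1 c t t0 isT (@normal R q.+1 p)) => //.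
  + exact: normal_linear.
  + exact: normal_alternating.
  + by have [J incJ AJ] := @normal_neq0 R q.+1 p; exists J, ord0.
  + by move=> K; exists (\det (normal_mx K : 'M[R]_q.+2)) => y;
      exact: wedge_normal.
  + by move=> K; exists 0 => y; rewrite mul0r -[in pad _ _](scale1r y)
      interior_normal_eq0.
  + by move=> y h a z J; rewrite interior_productZ interior_normal_eq0 mulr0.
Qed.
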